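(* Consider the projective splitting algorithm (one-forward-step, with backtracking for the indices in $\mathcal B$) described in the context, under the stated assumptions on the problem and on the parameters. If the algorithm terminates (because $\pi_k=0$ at some iteration $k$), then its final iterate $(z^{k+1},w_1^{k+1},\ldots,w_{n-1}^{k+1})$ is a member of $\mathcal S$. Otherwise, the sequence $\{(z^k,\mathbf w^k)\}$ generated by the algorithm converges weakly to some point $(\bar z,\overline{\mathbf w})=(\bar z,\overline w_1,\ldots,\overline w_{n-1})\in\mathcal S$. Furthermore, $x_i^k\rightharpoonup G_i\bar z$ and $y_i^k\rightharpoonup\overline w_i$ for all $i=1,\ldots,n-1$, $x_n^k\rightharpoonup\bar z$, and $y_n^k\rightharpoonup-\sum_{i=1}^{n-1}G_i^*\overline w_i$.
   Context: **Problem.** Let $n\ge 1$, let $\mathcal H_0=\mathcal H_n$ and $\mathcal H_1,\ldots,\mathcal H_{n-1}$ be real Hilbert spaces, and $\boldsymbol{\mathcal H}=\mathcal H_0\times\mathcal H_1\times\cdots\times\mathcal H_{n-1}$ with points $p=(z,\mathbf w)=(z,w_1,\ldots,w_{n-1})$ and the standard product inner product $\langle z^1,z^2\rangle+\sum_{i=1}^{n-1}\langle w_i^1,w_i^2\rangle$. Empty sums are $0$. For $i=1,\ldots,n$: $A_i:\mathcal H_i\to2^{\mathcal H_i}$ is maximal monotone; $B_i:\mathcal H_i\to\mathcal H_i$ is monotone, single-valued and everywhere defined, and either $L_i>0$ and $B_i$ is $L_i^{-1}$-cocoercive, i.e. $L_i\langle B_ix-B_ix',x-x'\rangle\ge\|B_ix-B_ix'\|^2$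 for all $x,x'$, or $L_i=0$ and $B_i$ is constant. $G_i:\mathcal H_0\to\mathcal H_i$ is linear and bounded, and $G_n=I$. Set $T_i=A_i+B_i$. The problem is to find $z$ with $0\in\sum_{i=1}^nG_i^*(A_i+B_i)G_iz$, assumed to have a solution, so that the set $\mathcal S=\{(z,w_1,\ldots,w_{n-1})\in\boldsymbol{\mathcal H}: w_i\in T_iG_iz\ (i=1,\ldots,n-1),\ -\sum_{i=1}^{n-1}G_i^*w_i\in T_nz\}$ is nonempty. $J_{\rho A}=(I+\rho A)^{-1}$ is the resolvent. **One-forward-step map.** For $\alpha\in[0,1]$, $\rho>0$, $\mathcal F_{\alpha,\rho}(z,x,w;A,B,G)=(x^+,y^+)$ with $t=(1-\alpha)x+\alpha Gz-\rho(Bx-w)$, $x^+=J_{\rho A}(t)$, $y^+=\rho^{-1}(t-x^+)+Bx^+$. **Parameters.** $\mathcal B\subseteq\{1,\ldots,n\}$ (indices with backtracking), $\gamma>0$, $\delta\in(0,1)$, $\hat\rho$; $(z^1,\mathbf w^1)\in\boldsymbol{\mathcal H}$; for every $i$: $x_i^0\in\mathcal H_i$, $0<\alpha_i\le1$, with $\alpha_i<1$ if $L_i>0$; for $i\in\mathcal B$: $\rho_i^0>0$, $\eta_i^0=0$, $\hat\theta_i\in\mathrm{dom}(A_i)$, $\hat w_i\in A_i\hat\theta_i+B_i\hat\theta_i$, $y_i^0\in A_ix_i^0+B_ix_i^0$; for $i\notin\mathcal B$: a fixed $\rho_i>0$ with $\rho_i\le2(1-\alpha_i)/L_i$ if $L_i>0$.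 Also $\hat\rho\ge\max\{\max_{i\in\mathcal B}\rho_i^0,\max_{i\notin\mathcal B}\rho_i\}$. Throughout $w_n^k=-\sum_{i=1}^{n-1}G_i^*w_i^k$. **Algorithm.** At each iteration $k=1,2,\ldots$: (1) For $i\in\mathcal B$ (backtracking): let $\varphi=\langle G_iz^k-x_i^{k-1},y_i^{k-1}-w_i^k\rangle$, $\bar\rho=\min\{(1+\alpha_i\eta_i^{k-1})\rho_i^{k-1},\hat\rho\}$, and choose any $\tilde\rho_1\in[\rho_i^{k-1},\bar\rho]$. For $j=1,2,\ldots$ compute $(\tilde x_j,\tilde y_j)=\mathcal F_{\alpha_i,\tilde\rho_j}(z^k,x_i^{k-1},w_i^k;A_i,B_i,G_i)$, $\hat y_j=\tilde\rho_j^{-1}((1-\alpha_i)x_i^{k-1}+\alpha_iG_iz^k-\tilde x_j)+w_i^k$, $\varphi_j^+=\langle G_iz^k-\tilde x_j,\tilde y_j-w_i^k\rangle$. If both $\|\tilde x_j-\hat\theta_i\|\le(1-\alpha_i)\|x_i^{k-1}-\hat\theta_i\|+\alpha_i\|G_iz^k-\hat\theta_i\|+\tilde\rho_j\|w_i^k-\hat w_i\|$ and $\varphi_j^+\ge\frac{\tilde\rho_j}{2\alpha_i}(\|\tilde y_j-w_i^k\|^2+\alpha_i\|\hat y_j-w_i^k\|^2)+(1-\alpha_i)(\varphi-\frac{\tilde\rho_j}{2\alpha_i}\|y_i^{k-1}-w_i^k\|^2)$ hold, stop backtracking and set $x_i^k=\tilde x_j$, $y_i^k=\tilde y_j$, $\rho_i^k=\tilde\rho_j$,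 $\eta_i^k=\|\hat y_j-w_i^k\|^2/\|\tilde y_j-w_i^k\|^2$ (any value in $[0,+\infty]$ if the denominator is $0$); otherwise set $\tilde\rho_{j+1}=\delta\tilde\rho_j$ and continue. (2) For $i\notin\mathcal B$: $(x_i^k,y_i^k)=\mathcal F_{\alpha_i,\rho_i}(z^k,x_i^{k-1},w_i^k;A_i,B_i,G_i)$. (3) Projection: $u_i=x_i^k-G_ix_n^k$ ($i=1,\ldots,n-1$), $v=\sum_{i=1}^{n-1}G_i^*y_i^k+y_n^k$, $\pi_k=\sum_{i=1}^{n-1}\|u_i\|^2+\gamma^{-1}\|v\|^2$. If $\pi_k=0$, set $z^{k+1}=x_n^k$, $w_i^{k+1}=y_i^k$ ($i\le n-1$) and terminate. Otherwise $\tau=\frac1{\pi_k}\max\{0,\langle z^k,v\rangle+\sum_{i=1}^{n-1}\langle w_i^k,u_i\rangle-\sum_{i=1}^n\langle x_i^k,y_i^k\rangle\}$, $z^{k+1}=z^k-\gamma^{-1}\tau v$, $w_i^{k+1}=w_i^k-\tau u_i$ ($i\le n-1$). *)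

(* Defs.v *)
From HB Require Import structures.
From mathcomp Require Import all_boot all_order all_algebra.
From mathcomp Require Import all_classical all_reals all_analysis.

Set Implicit Arguments.
Unset Strict Implicit.
Unset Printing Implicit Defensive.
Import Order.TTheory GRing.Theory Num.Theory numFieldNormedType.Exports.
Local Open Scope classical_set_scope.
Local Open Scope ring_scope.

(* Real Hilbert spaces: complete normed spaces whose norm is induced by a
   symmetric, bilinear, positive definite form. *)
HB.mixin Record CompleteNormedModule_isHilbert (R : realType) V
    & CompleteNormedModule R V := {
  inner : {dot V for (@idfun R)} ;
  sqr_norm_inner : forall x : V, `|x| ^+ 2 = inner x x
}.

#[short(type="hilbertType")]
HB.structure Definition Hilbert (R : realType) :=
  {V of CompleteNormedModule R V & CompleteNormedModule_isHilbert R V}.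

Section Operators.
Context {R : realType}.
Implicit Types V W : hilbertType R.

Definition bounded_operator V W (f : V -> W) : Prop :=
  exists M : R, forall x, `|f x| <= M * `|x|.

(* For a bounded linear f, the vector x below exists (Riesz) and is unique. *)
Definition adjoint V W (f : V -> W) (y : W) : V :=
  xget 0 [set x : V | forall v, inner (f v) y = inner v x].

(* A set-valued operator V -> 2^V is a function A : V -> set V. *)
Definition monotone V (A : V -> set V) : Prop :=
  forall x x' a a', A x a -> A x' a' -> 0 <= inner (x - x') (a - a').

Definition maximal_monotone V (A : V -> set V) : Prop :=
  monotone A /\
  forall A' : V -> set V,
    monotone A' -> (forall x, A x `<=` A' x) -> A' = A.

Definition monotone_map V (B : V -> V) : Prop :=
  forall x x', 0 <= inner (x - x') (B x - B x').

(* L^-1-cocoercivity, in the form that does not divide by L. *)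
Definition cocoercive V (L : R) (B : V -> V) : Prop :=
  forall x x', `|B x - B x'| ^+ 2 <= L * inner (B x - B x') (x - x').

Definition op_add V (A : V -> set V) (B : V -> V) : V -> set V :=
  fun x => [set a + B x | a in A x].

Definition op_dom V (A : V -> set V) : set V := [set x | A x !=set0].

(* J_(rho A) = (I + rho A)^-1, the inverse being that of a set-valued operator. *)
Definition resolvent V (rho : R) (A : V -> set V) : V -> set V :=
  fun t => [set x | exists2 a, A x a & t = x + rho *: a].

(* (x', y') = F_(alpha,rho)(z, x, w; A, B, G). *)
Definition one_forward_step V W (alpha rho : R) (A : W -> set W) (B : W -> W)
    (G : V -> W) (z : V) (x w : W) (x' y' : W) : Prop :=
  let t := (1 - alpha) *: x + alpha *: G z - rho *: (B x - w) in
  resolvent rho A t = [set x'] /\ y' = rho^-1 *: (t - x') + B x'.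

Definition weak_cvg (X : Type) (ip : X -> X -> R) (u : nat -> X) (l : X) : Prop :=
  forall p, (fun k => ip (u k) p) @ \oo --> ip l p.

End Operators.

(* The index set {1, ..., n} is encoded as option 'I_m with m = n - 1:
   Some j (j < m) is the index j + 1 <= n - 1 and None is the index n, whose
   space H_n is H_0. *)
Section Spaces.
Context {R : realType} (m : nat) (H0 : hilbertType R) (H : 'I_m -> hilbertType R).

Definition space (i : option 'I_m) : hilbertType R :=
  if i is Some j then H j else H0.

Definition point : Type := (H0 * (forall j : 'I_m, H j))%type.

Definition prod_inner (p q : point) : R :=
  inner p.1 q.1 + \sum_(j < m) inner (p.2 j) (q.2 j).

Record problem := MkProblem {
  opA : forall i, space i -> set (space i) ;
  opB : forall i, space i -> space i ;
  cstL : option 'I_m -> R ;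
  linG : forall j : 'I_m, {linear H0 -> H j}
}.

Record parameters := MkPar {
  btB : {set option 'I_m} ; (* the indices with backtracking *)
  gam : R ;
  del : R ;
  rhohat : R ;
  z1 : H0 ;
  w1 : forall j, H j ;
  x0 : forall i, space i ;
  alp : option 'I_m -> R ;
  (* used for the indices in btB only *)
  rho0 : option 'I_m -> R ;
  thetahat : forall i, space i ;
  what : forall i, space i ;
  y0 : forall i, space i ;
  (* used for the indices outside btB only *)
  rhofix : option 'I_m -> R
}.

(* zs, ws are meaningful at iterations k >= 1, the others at k >= 0;
   rhos and etas only at the indices with backtracking. *)
Record trace := MkTrace {
  zs : nat -> H0 ;
  ws : nat -> forall j, H j ;
  xs : nat -> forall i, space i ;
  ys : nat -> forall i, space i ;
  rhos : nat -> option 'I_m -> R ;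
  etas : nat -> option 'I_m -> \bar R
}.

Section Algorithm.
Variable P : problem.

Definition opT (i : option 'I_m) : space i -> set (space i) :=
  op_add (@opA P i) (@opB P i).

Definition mapG (i : option 'I_m) : H0 -> space i :=
  match i return H0 -> space i with
  | Some j => linG P j
  | None => fun z => z
  end.

(* w_n = - \sum_(i < n) G_i^* w_i. *)
Definition w_last (w : forall j, H j) : H0 :=
  - \sum_(j < m) adjoint (linG P j) (w j).

Definition w_ext (w : forall j, H j) (i : option 'I_m) : space i :=
  match i return space i with
  | Some j => w j
  | None => w_last w
  end.

Definition inclusion_operator (z : H0) : set H0 :=
  [set s | exists t : forall i, space i,
    (forall i, @opT i (mapG i z) (t i)) /\
    s = \sum_(i : option 'I_m) adjoint (mapG i) (t i)].

Definition problem_ok : Prop :=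
  [/\ forall i, maximal_monotone (@opA P i),
      forall i, monotone_map (@opB P i),
      forall i, (0 < cstL P i /\ cocoercive (cstL P i) (@opB P i)) \/
                (cstL P i = 0 /\ forall x x', @opB P i x = @opB P i x'),
      forall j, bounded_operator (linG P j)
    & exists z, inclusion_operator z 0].

Definition solution_set : set point :=
  [set p | (forall j, @opT (Some j) (linG P j p.1) (p.2 j)) /\
           @opT None p.1 (w_last p.2)].

Variable par : parameters.

Definition parameters_ok : Prop :=
  [/\ 0 < gam par, 0 < del par < 1,
      forall i, 0 < alp par i <= 1 /\ (0 < cstL P i -> alp par i < 1),
      forall i, i \in btB par ->
        [/\ 0 < rho0 par i, rho0 par i <= rhohat par,
            op_dom (@opA P i) (thetahat par i),
            @opT i (thetahat par i) (what par i)
          & @opT i (x0 par i) (y0 par i)]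
    & forall i, i \notin btB par ->
        [/\ 0 < rhofix par i, rhofix par i <= rhohat par
          & 0 < cstL P i -> rhofix par i <= 2 * (1 - alp par i) / cstL P i]].

Variable tr : trace.

Definition initialized : Prop :=
  [/\ zs tr 1 = z1 par, ws tr 1 = w1 par, xs tr 0 = x0 par
    & forall i, i \in btB par ->
        [/\ ys tr 0 i = y0 par i, rhos tr 0 i = rho0 par i
          & etas tr 0 i = 0%E]].

Definition one_forward (k : nat) (i : option 'I_m) (rho : R)
    (x' y' : space i) : Prop :=
  one_forward_step (alp par i) rho (@opA P i) (@opB P i) (mapG i)
    (zs tr k) (xs tr k.-1 i) (w_ext (ws tr k) i) x' y'.

Definition y_hat (k : nat) (i : option 'I_m) (rho : R) (xt : space i) : space i :=
  rho^-1 *: ((1 - alp par i) *: xs tr k.-1 i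
             + alp par i *: mapG i (zs tr k) - xt)
  + w_ext (ws tr k) i.

Definition backtrack_test (k : nat) (i : option 'I_m) (rho : R)
    (xt yt : space i) : Prop :=
  let a := alp par i in
  let Gz := mapG i (zs tr k) in
  let x := xs tr k.-1 i in
  let y := ys tr k.-1 i in
  let w := w_ext (ws tr k) i in
  let theta := thetahat par i in
  let phi := inner (Gz - x) (y - w) in
  let phi_plus := inner (Gz - xt) (yt - w) in
  `|xt - theta| <= (1 - a) * `|x - theta| + a * `|Gz - theta|
                   + rho * `|w - what par i| /\
  phi_plus >= rho / (2 * a)
                * (`|yt - w| ^+ 2 + a * `|y_hat k rho xt - w| ^+ 2)
              + (1 - a) * (phi - rho / (2 * a) * `|y - w| ^+ 2).

(* The trials j = 1, 2, ... are numbered from 0.  The results of the step are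
   those of the first trial that passes the test.  That some trial passes is not
   assumed: if none did, the results of the step would be unconstrained. *)
Definition backtracking_step (k : nat) (i : option 'I_m) : Prop :=
  exists (rt : nat -> R) (xt yt : nat -> space i),
  [/\ rhos tr k.-1 i <= rt 0%N,
      ((rt 0%N)%:E <=
         mine ((1 + (alp par i)%:E * etas tr k.-1 i) * (rhos tr k.-1 i)%:E)
              (rhohat par)%:E)%E,
      forall j, rt j.+1 = del par * rt j,
      forall j, one_forward k (rt j) (xt j) (yt j)
    & forall j,
        backtrack_test k (rt j) (xt j) (yt j) ->
        (forall l, (l < j)%N -> ~ backtrack_test k (rt l) (xt l) (yt l)) ->
        let w := w_ext (ws tr k) i in
        [/\ xs tr k i = xt j, ys tr k i = yt j, rhos tr k i = rt j,
            yt j = w -> (0 <= etas tr k i)%E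
          & yt j <> w -> etas tr k i = (`|y_hat k (rt j) (xt j) - w| ^+ 2
                                        / `|yt j - w| ^+ 2)%:E]].

Definition processing_step (k : nat) : Prop :=
  forall i, if i \in btB par then backtracking_step k i
            else one_forward k (rhofix par i) (xs tr k i) (ys tr k i).

Definition dir_u (k : nat) (j : 'I_m) : H j :=
  xs tr k (Some j) - linG P j (xs tr k None).

Definition dir_v (k : nat) : H0 :=
  \sum_(j < m) adjoint (linG P j) (ys tr k (Some j)) + ys tr k None.

Definition pi_ (k : nat) : R :=
  \sum_(j < m) `|dir_u k j| ^+ 2 + (gam par)^-1 * `|dir_v k| ^+ 2.

Definition tau (k : nat) : R :=
  (pi_ k)^-1 *
  Num.max 0 (inner (zs tr k) (dir_v k)
             + \sum_(j < m) inner (ws tr k j) (dir_u k j)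
             - \sum_(i : option 'I_m) inner (xs tr k i) (ys tr k i)).

Definition projection_step (k : nat) : Prop :=
  zs tr k.+1 = zs tr k - ((gam par)^-1 * tau k) *: dir_v k /\
  forall j, ws tr k.+1 j = ws tr k j - tau k *: dir_u k j.

Definition final_step (k : nat) : Prop :=
  zs tr k.+1 = xs tr k None /\ forall j, ws tr k.+1 j = ys tr k (Some j).

Definition terminates_at (K : nat) : Prop :=
  [/\ (1 <= K)%N, initialized,
      forall k, (1 <= k < K)%N ->
        [/\ processing_step k, pi_ k <> 0 & projection_step k]
    & [/\ processing_step K, pi_ K = 0 & final_step K]].

Definition runs_forever : Prop :=
  initialized /\
  forall k, (1 <= k)%N ->
    [/\ processing_step k, pi_ k <> 0 & projection_step k].

End Algorithm.
End Spaces.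

(* Main.v *)
Require Import Defs.
From HB Require Import structures.
From mathcomp Require Import all_boot all_order all_algebra.
From mathcomp Require Import all_classical all_reals all_analysis.
From mathcomp Require Import ring lra.

Set Implicit Arguments.
Unset Strict Implicit.
Unset Printing Implicit Defensive.
Import Order.TTheory GRing.Theory Num.Theory numFieldNormedType.Exports.
Local Open Scope classical_set_scope.
Local Open Scope ring_scope.

(** The proof rests on an affine function that separates the current iterate from
the solutions.  For (x_i, y_i) in the graph of T_i, put
  sep_k (z, w) = \sum_i <G_i z - x_i^k, y_i^k - w_i>,
where w_n = - \sum_(i < n) G_i^* w_i.  As \sum_i <G_i z, w_i> = 0, this is affine
in (z, w), with gradient (v, u), and monotonicity makes it nonpositive on S.  The
projection step is the orthogonal projection onto the half-space sep_k <= 0 for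
the norm whose square is gamma |z|^2 + \sum_i |w_i|^2.  So the distance to every
solution does not increase, and its decrease controls tau_k^2 pi_k
(fejer_monotone).  Hence the iterates are bounded and the distance between
successive iterates tends to 0.  If pi_k = 0 the points (x_i, y_i) themselves
form a solution (terminates_solution).

The main point is that sep_k is, up to a vanishing error, positive at the current
iterate unless the points (x_i, y_i) are close to (G_i z, w_i).  When rho L <= 2 (1 - alpha) the
averaged forward step satisfies both backtracking tests (step_norm and
step_ascent), so backtracking ends and the step sizes stay away from 0
(backtracking_stepP).  The first test is a contractive recursion that bounds
x_i, hence y_i (iterates_bounded).  The second one is also a contractive
recursion, up to the vanishing motion of the iterates, for the quantity
  phi - rho / (2 alpha) (|y - w|^2 + alpha |yhat - w|^2),
where phi = <G z - x, y - w> and the index i is left out, because the growth rule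
for rho is the one that makes this quantity comparable at successive iterations;
its negative part therefore tends to 0 (inner_lower_bound).  Summing over i, and using that the positive part of sep_k
at the iterates tends to 0 (sep_cvg), one gets y_i - w_i -> 0 and then
x_i - G_i z -> 0 (residuals_cvg).

Bounded sequences have weak limits along every ultrafilter, by compactness of
real segments and the Riesz representation theorem (ultra_weak_limit).  Such a
limit is a solution (weak_cluster_solution): testing the cocoercivity of B_i
against one solution z shows that B_i x_i converges strongly to B_i G_i z
(B_cvg), so the monotonicity inequalities of the A_i alone pass to the limit, and
the maximality of the A_i applies; the cocoercivity of B_i is used once more to
see that the limit of B_i x_i is the value of B_i at the limit.  Finally the
argument of Opial shows that the limit does not depend on the ultrafilter
(weak_limits_agree), which is convergence of the whole sequence. *)

(** * Limits along a filter and inner products *)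

Section Convergence.
Context {R : realType} {T : Type} {F : set_system T} {FF : ProperFilter F}.

Lemma cvg_dominated (V : normedModType R) (u : T -> V) l (e : T -> R) :
  (\forall t \near F, `|u t - l| <= e t) -> e t @[t --> F] --> 0 -> u t @[t --> F] --> l.
Proof.
move=> ue /cvgrPdist_lt e0; apply/cvgrPdist_lt => r r0.
near=> t; rewrite distrC; apply: (@le_lt_trans _ _ (e t)); first by near: t.
apply: le_lt_trans (ler_norm _) _; rewrite -normrN -sub0r; near: t; exact: e0.
Unshelve. all: by end_near.
Qed.

Lemma cvg_distP (V : normedModType R) (u : T -> V) l :
  `|u t - l| @[t --> F] --> 0 <-> u t @[t --> F] --> l.
Proof.
split=> [h|h]; first by apply: (cvg_dominated _ h); exact: nearW.
rewrite -(normr0 V) -(subrr l); apply: cvg_norm; apply: cvgB => //; exact: cvg_cst.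
Qed.

Lemma cvg0_dominated (f e : T -> R) : (forall t, 0 <= f t <= e t) ->
  e t @[t --> F] --> 0 -> f t @[t --> F] --> 0.
Proof.
move=> fe; apply: cvg_dominated; apply: nearW => t; rewrite subr0.
by have /andP[f0 fe'] := fe t; rewrite ger0_norm.
Qed.

Lemma cvg0_sqr (f : T -> R) : f t ^+ 2 @[t --> F] --> 0 -> f t @[t --> F] --> 0.
Proof.
move=> /cvgrPdist_lt h; apply/cvgrPdist_lt => e e0.
have := h (e ^+ 2) (exprn_gt0 _ e0); apply: filterS => t.
by rewrite !sub0r !normrN normrX ltr_sqr ?nnegrE// ltW.
Qed.

Lemma cvg_sumr (I : Type) (r : seq I) (f : I -> T -> R) (l : I -> R) :
  (forall i, f i t @[t --> F] --> l i) ->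
  \sum_(i <- r) f i t @[t --> F] --> \sum_(i <- r) l i.
Proof.
move=> h; elim: r => [|i r IH].
  by rewrite big_nil; under eq_cvg do rewrite big_nil; exact: cvg_cst.
by rewrite big_cons; under eq_cvg do rewrite big_cons; apply: cvgD.
Qed.

Lemma cvg_sum0 (I : finType) (f : I -> T -> R) :
  (forall i, f i t @[t --> F] --> 0) -> \sum_(i : I) f i t @[t --> F] --> 0.
Proof. by move=> h; have := cvg_sumr (r := index_enum I) h; rewrite big1_eq. Qed.

Lemma cvg_sub_filter (S : topologicalType) (U : set_system T) (f : T -> S) (l : S) :
  F `<=` U -> f t @[t --> F] --> l -> f t @[t --> U] --> l.
Proof. by move=> FU h A /h; exact: FU. Qed.

Lemma cvg0Dl (f g : T -> R) (l : R) :
  f t @[t --> F] --> 0 -> g t @[t --> F] --> l -> f t + g t @[t --> F] --> l.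
Proof. by move=> f0 gl; rewrite -[l]add0r; apply: cvgD. Qed.

Lemma cvg0D (f g : T -> R) :
  f t @[t --> F] --> 0 -> g t @[t --> F] --> 0 -> f t + g t @[t --> F] --> 0.
Proof. exact: cvg0Dl. Qed.
End Convergence.

Section InnerProduct.
Context {R : realType}.
Implicit Types V W : hilbertType R.

Lemma innerC V (x y : V) : inner x y = inner y x.
Proof. by rewrite (hermC inner x y) expr0 mul1r. Qed.
Lemma innerDl V (x y z : V) : inner (x + y) z = inner x z + inner y z.
Proof. exact: linearDl. Qed.
Lemma innerDr V (x y z : V) : inner z (x + y) = inner z x + inner z y.
Proof. exact: linearDr. Qed.
Lemma innerNl V (x z : V) : inner (- x) z = - inner x z.
Proof. exact: linearNl. Qed.
Lemma innerNr V (x z : V) : inner z (- x) = - inner z x.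
Proof. exact: linearNr. Qed.
Lemma innerZl V a (x z : V) : inner (a *: x) z = a * inner x z.
Proof. exact: linearZl_LR. Qed.
Lemma innerZr V a (x z : V) : inner z (a *: x) = a * inner z x.
Proof. exact: linearZr_LR. Qed.
Lemma inner0l V (z : V) : inner 0 z = 0.
Proof. exact: linear0l. Qed.
Lemma inner0r V (z : V) : inner z 0 = 0.
Proof. exact: linear0r. Qed.
Lemma inner_suml V I r (Q : pred I) (F : I -> V) z :
  inner (\sum_(i <- r | Q i) F i) z = \sum_(i <- r | Q i) inner (F i) z.
Proof. exact: linear_sumlz. Qed.
Lemma inner_sumr V I r (Q : pred I) (F : I -> V) z :
  inner z (\sum_(i <- r | Q i) F i) = \sum_(i <- r | Q i) inner z (F i).
Proof. exact: linear_sumr. Qed.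

Definition innerE := (@innerDl, @innerDr, @innerNl, @innerNr, @innerZl, @innerZr).

Lemma inner_sqr V (x : V) : inner x x = `|x| ^+ 2.
Proof. by rewrite sqr_norm_inner. Qed.

Lemma ler_sqr_norm V (x y : V) : inner x x <= inner y y -> `|x| <= `|y|.
Proof. by rewrite !inner_sqr ler_sqr ?nnegrE. Qed.

Lemma sqr_normD V (x y : V) :
  `|x + y| ^+ 2 = `|x| ^+ 2 + 2 * inner x y + `|y| ^+ 2.
Proof. rewrite -!inner_sqr !innerE (innerC y x); ring. Qed.

Lemma norm_le_sqr (V : hilbertType R) (x : V) M : `|x| ^+ 2 <= M -> `|x| <= M + 1.
Proof. by have := sqr_ge0 (`|x| - 1); have := normr_ge0 x; nra. Qed.

Lemma cauchy_schwarz V (x y : V) : `|inner x y| <= `|x| * `|y|.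
Proof.
have [->|y0] := eqVneq y 0; first by rewrite inner0r !normr0 mulr0.
have ny : 0 < `|y| by rewrite normr_gt0.
rewrite -(ler_sqr (normr_ge0 _)) ?nnegrE ?mulr_ge0// exprMn real_normK ?num_real//.
have : 0 <= `| `|y| ^+ 2 *: x - inner x y *: y| ^+ 2 by rewrite exprn_ge0.
rewrite -(inner_sqr (_ - _)) !innerE (innerC y x) !inner_sqr.
set s := (X in 0 <= X).
have -> : s = `|y| ^+ 2 * (`|x| ^+ 2 * `|y| ^+ 2 - inner x y ^+ 2) by rewrite /s; ring.
by rewrite pmulr_rge0 ?exprn_gt0// subr_ge0.
Qed.

Lemma parallelogram V (x y : V) :
  `|x - y| ^+ 2 = 2 * `|x| ^+ 2 + 2 * `|y| ^+ 2 - 4 * `|2^-1 *: (x + y)| ^+ 2.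
Proof. rewrite -!inner_sqr !innerE (innerC y x); lra. Qed.

(** A minimizer of |x|^2 - 2 f x represents f.  Minimizing sequences are Cauchy by
the parallelogram identity, since its value at a midpoint is at least the infimum. *)
Lemma riesz V (f : V -> R) (M : R) :
  (forall a u v, f (a *: u + v) = a * f u + f v) ->
  (forall v, `|f v| <= M * `|v|) -> exists x : V, forall v, f v = inner v x.
Proof.
move=> flin fM.
have fD u v : f (u + v) = f u + f v by rewrite -[u]scale1r flin scale1r mul1r.
have f0 : f 0 = 0 by have := fD 0 0; rewrite addr0 => h; lra.
have fZ a u : f (a *: u) = a * f u by rewrite -[a *: u]addr0 flin f0 addr0.
have fB u v : f (u - v) = f u - f v by rewrite fD -scaleN1r fZ mulN1r.
pose J x : R := `|x| ^+ 2 - 2 * f x.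
pose E := range J.
have J_ge x : - M ^+ 2 <= J x.
  have := fM x; rewrite /J => fx; have := ler_norm (f x).
  have := sqr_ge0 (`|x| - M); nra.
have E0 : E !=set0 by exists (J 0), 0.
have Elb : has_inf E by split => //; exists (- M ^+ 2) => _ [x _ <-].
pose d := inf E.
have J_d x : d <= J x by apply: ge_inf; [case: Elb | exists x].
have ex n : exists x, J x < d + n.+1%:R^-1.
  have [_ [x _ <-] h] := @inf_adherent _ E n.+1%:R^-1 ltac:(by rewrite invr_gt0) Elb.
  by exists x.
pose x n := sval (cid (ex n)).
have xP n : J (x n) < d + n.+1%:R^-1 by rewrite /x; case: (cid _).
have xd p q : `|x p - x q| ^+ 2 <= 2 * (p.+1%:R^-1 + q.+1%:R^-1).
  rewrite parallelogram; have := J_d (2^-1 *: (x p + x q)).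
  have := xP p; have := xP q; rewrite /J fZ fD.
  move: (p.+1%:R^-1) (q.+1%:R^-1) => a b; lra.
have xcvg : cvg (x @ \oo).
  apply: cauchy_cvg; apply: cauchy_exP => e e0.
  have [k] := @ltr_add_invr _ 0 (e ^+ 2 / 4) ltac:(by rewrite divr_gt0// exprn_gt0).
  rewrite add0r => hk; exists (x k).
  suff : \forall p \near \oo, ball (x k) e (x p) by [].
  near=> p; rewrite -ball_normE /ball_ /= -(ltr_sqr (normr_ge0 _)) ?nnegrE ?ltW//.
  have pk : p.+1%:R^-1 <= k.+1%:R^-1 :> R.
    by rewrite lef_pV2 ?posrE// ler_nat ltnS; near: p; exists k.
  move: (xd k p) pk hk; move: (p.+1%:R^-1) (k.+1%:R^-1) => a b; lra.
pose l := lim (x @ \oo).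
have xl : x n @[n --> \oo] --> l by exact: xcvg.
have Jc : J (x n) @[n --> \oo] --> J l.
  apply: (@cvgB _ R^o).
    by apply: (@cvgM _ _ _ _ (fun n => `|x n|) (fun n => `|x n|)); apply: cvg_norm xl.
  apply: cvgM; first exact: cvg_cst.
  apply: (cvg_dominated (e := fun n => M * `|x n - l|)).
    by apply: nearW => n; rewrite -fB; exact: fM.
  by rewrite -[0](mulr0 M); apply: cvgM; [exact: cvg_cst | exact/cvg_distP].
have Jl : J l <= d.
  apply: (ler_cvg_to Jc (_ : (d + n.+1%:R^-1) @[n --> \oo] --> d)).
    by rewrite -[d in X in _ --> X]addr0; apply: cvgD; [exact: cvg_cst | exact: cvg_harmonic].
  by apply: nearW => n; exact/ltW.
exists l => v.
have h t : 0 <= 2 * t * (inner v l - f v) + t ^+ 2 * `|v| ^+ 2.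
  have := le_trans Jl (J_d (l + t *: v)).
  rewrite /J sqr_normD fD fZ innerZr (innerC l v) normrZ exprMn real_normK ?num_real//.
  lra.
(* Adding 1 to the optimal denominator |v|^2 keeps it nonzero when v = 0. *)
have := h (- (inner v l - f v) / (`|v| ^+ 2 + 1)).
set a := inner v l - f v.
have nv : 0 <= `|v| ^+ 2 by rewrite exprn_ge0.
have nv1 : 0 < `|v| ^+ 2 + 1 by lra.
rewrite -(pmulr_rge0 _ (exprn_gt0 2 nv1)).
have -> : (`|v| ^+ 2 + 1) ^+ 2 * (2 * (- a / (`|v| ^+ 2 + 1)) * a
      + (- a / (`|v| ^+ 2 + 1)) ^+ 2 * `|v| ^+ 2) = - a ^+ 2 * (`|v| ^+ 2 + 2).
  by field; rewrite lt0r_neq0.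
move=> h1; have : a ^+ 2 <= 0 by nra.
rewrite real_exprn_even_le0 ?num_real// /a; lra.
Unshelve. all: by end_near.
Qed.
End InnerProduct.

(** * Adjoints, ultrafilters and contractive recursions *)

Section Adjoint.
Context {R : realType}.
Implicit Types V W : hilbertType R.

(** Reduces a vector identity to one between real numbers, which can be expanded
by innerE and closed by ring or field. *)
Lemma inner_ext V (x y : V) : (forall v, inner v x = inner v y) -> x = y.
Proof.
move=> h; apply/eqP; rewrite -subr_eq0 -normr_eq0 -sqrf_eq0 -inner_sqr.
by rewrite innerDr innerNr h subrr.
Qed.

(** The adjoint is defined by a choice operator; boundedness provides, through the
Riesz theorem, the vector to be chosen. *)
Lemma adjointP V W (f : {linear V -> W}) : bounded_operator f ->
  forall v y, inner (f v) y = inner v (adjoint f y).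
Proof.
move=> [M fM] v y.
have [x xP] : exists x : V, forall v, inner (f v) y = inner v x.
  apply: (riesz (M := M * `|y|)) => [a u u'|u].
    by rewrite linearP innerDl innerZl.
  apply: le_trans (cauchy_schwarz _ _) _; rewrite mulrAC.
  by apply: ler_wpM2r.
by rewrite /adjoint; case: xgetP => [x0 _ /(_ v)|/(_ x)].
Qed.

Lemma adjoint_id V (y : V) : adjoint (fun x : V => x) y = y.
Proof.
apply: inner_ext => v; rewrite /adjoint; case: xgetP => [x0 _ ->//|/(_ y)].
by case.
Qed.

Lemma adjointB V W (f : {linear V -> W}) : bounded_operator f ->
  {morph adjoint f : x y / x - y}.
Proof.
move=> fb x y; apply: inner_ext => v.
by rewrite innerDr innerNr -!adjointP// innerDr innerNr.
Qed.

Lemma bounded_operator_ge0 V W (f : V -> W) : bounded_operator f ->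
  exists2 M : R, 0 <= M & forall x, `|f x| <= M * `|x|.
Proof.
move=> [M fM]; exists (Num.max 0 M) => [|x]; first by rewrite le_max lexx.
by apply: le_trans (fM x) _; apply: ler_wpM2r => //; rewrite le_max lexx orbT.
Qed.

Lemma adjoint_bounded V W (f : {linear V -> W}) (M : R) : 0 <= M ->
  (forall x, `|f x| <= M * `|x|) -> forall y, `|adjoint f y| <= M * `|y|.
Proof.
move=> M0 fM y; have fb : bounded_operator f by exists M.
have [->|x0] := eqVneq (adjoint f y) 0; first by rewrite normr0 mulr_ge0.
have nx : 0 < `|adjoint f y| by rewrite normr_gt0.
rewrite -(ler_pM2l nx) -expr2 -inner_sqr -adjointP//.
apply: le_trans (ler_norm _) _; apply: le_trans (cauchy_schwarz _ _) _.
by rewrite [leRHS]mulrCA mulrA; apply: ler_wpM2r.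
Qed.
End Adjoint.

Section UltraFilters.
Context {R : realType} {T : Type}.

(** A segment is compact, and a cluster point of an ultrafilter is a limit. *)
Lemma ultra_bounded_cvg (U : set_system T) (f : T -> R) (M : R) :
  UltraFilter U -> (\forall t \near U, `|f t| <= M) ->
  exists2 c, `|c| <= M & f t @[t --> U] --> c.
Proof.
move=> UU fM.
have : (f @ U) `[- M, M]%classic.
  by apply: filterS fM => t /=; rewrite in_itv/= ler_norml.
move=> /(segment_compact _) [c []]; rewrite /= in_itv/= -ler_norml => cM cl.
exists c => // A Ac; rewrite /nbhs/=.
have [//|UA] := in_ultra_setVsetC (f @^-1` A) UU.
by have [x []] := cl (~` A) A UA Ac.
Qed.

(** If A is a neighbourhood of l whose preimage is not in F, some ultrafilter above
F contains the complement of that preimage. *)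
Lemma cvg_from_ultra (F : set_system T) (S : topologicalType) (f : T -> S) (l : S) :
  Filter F ->
  (forall U, UltraFilter U -> F `<=` U -> f t @[t --> U] --> l) ->
  f t @[t --> F] --> l.
Proof.
move=> FF h A Al; rewrite /nbhs/=; apply: contrapT => nA.
have PF : ProperFilter (within (~` (f @^-1` A)) F).
  apply: Build_ProperFilter_ex => B; rewrite /within /= => FB.
  apply: contrapT => nB; apply: nA; apply: filterS FB => t tB.
  by apply: contrapT => nt; apply: nB; exists t; exact: tB.
have [U [UU sU]] := ultraFilterLemma PF.
have FU : F `<=` U.
  by move=> B FB; apply: sU; apply: filterS FB.
have UA : U (f @^-1` A) by exact: h.
have UnA : U (~` (f @^-1` A)) by apply: sU; exact: nearW.
by have [t []] := filter_ex (filterI UA UnA).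
Qed.

(** The pointwise limits of the functionals inner (u t) along U form a bounded
linear functional, which the Riesz theorem represents.  Ultrafilters play the role of
weakly convergent subsequences. *)
Lemma ultra_weak_limit (V : hilbertType R) (U : set_system T) (u : T -> V) (M : R) :
  UltraFilter U -> (\forall t \near U, `|u t| <= M) ->
  exists l, forall h, inner (u t) h @[t --> U] --> inner l h.
Proof.
move=> UU uM.
have lim h : exists2 c, `|c| <= M * `|h| & inner (u t) h @[t --> U] --> c.
  apply: ultra_bounded_cvg; apply: filterS uM => t ut.
  by apply: le_trans (cauchy_schwarz _ _) _; apply: ler_wpM2r.
pose f h := s2val (cid2 (lim h)).
have fM h : `|f h| <= M * `|h| by rewrite /f; case: (cid2 _).
have fP h : inner (u t) h @[t --> U] --> f h by rewrite /f; case: (cid2 _).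
have [l lP] : exists l, forall h, f h = inner h l.
  apply: riesz fM => a x y; apply: (cvg_unique _ (fP _)) => //.
  rewrite (_ : (fun _ => _) = (fun t => a * inner (u t) x + inner (u t) y)); last first.
    by apply/funext => t; rewrite innerDr innerZr.
  by apply: cvgD => //; apply: cvgM => //; exact: cvg_cst.
by exists l => h; rewrite innerC -lP.
Qed.
End UltraFilters.

Section Recursions.
Context {R : realType}.

(** C / (1 - q) is the fixed point of a |-> q a + C. *)
Lemma bounded_recursion (q C : R) (a : nat -> R) : 0 <= q < 1 ->
  (forall k, a k.+1 <= q * a k + C) -> exists M, forall k, a k <= M.
Proof.
move=> /andP[q0 q1] h; exists (Num.max (a 0%N) (C / (1 - q))).
elim=> [|k IH]; first by rewrite le_max lexx.
set M := Num.max _ _ in IH *.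
have : C / (1 - q) <= M by rewrite /M le_max lexx orbT.
rewrite ler_pdivrMr ?subr_gt0// => hC.
by have := h k; nra.
Qed.

(** From some index on, e k <= (1 - q) r / 2, and then a - r / 2 contracts by the
factor q. *)
Lemma cvg0_recursion (q : R) (a e : nat -> R) : 0 <= q < 1 ->
  (forall k, 0 <= a k) -> (\forall k \near \oo, a k.+1 <= q * a k + e k) ->
  e k @[k --> \oo] --> 0 -> a k @[k --> \oo] --> 0.
Proof.
move=> /andP[q0 q1] a0 h /cvgrPdist_lt e0; apply/cvgrPdist_le => r r0.
have r2 : 0 < r / 2 by lra.
have /e0 : 0 < (1 - q) * (r / 2) by nra.
move=> e1; have [N _ NP] := filterI h e1.
have step j : a (N + j)%N <= r / 2 + q ^+ j * a N.
  elim: j => [|j IH]; first by rewrite addn0 expr0 mul1r; lra.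
  have [/= h1] := NP (N + j)%N (leq_addr _ _).
  rewrite sub0r normrN => /(le_lt_trans (ler_norm _)) h2.
  rewrite addnS exprS; move: (q ^+ j * a N) IH (mulrA q (q ^+ j) (a N)) => s IH <-.
  nra.
have gq : q ^+ j * a N @[j --> \oo] --> 0.
  rewrite -[X in _ --> X](mul0r (a N)); apply: cvgM; last exact: cvg_cst.
  by apply: cvg_expr; rewrite ger0_norm.
move/cvgrPdist_lt : gq => /(_ _ r2) [K _ KP].
exists (N + K)%N => // k /= kNK; rewrite sub0r normrN ger0_norm//.
have /KP : (K <= k - N)%N by rewrite leq_subRL// (leq_trans _ kNK)// leq_addr.
rewrite /= sub0r normrN => /(le_lt_trans (ler_norm _)) h2.
have := step (k - N)%N; rewrite subnKC ?(leq_trans _ kNK)// ?leq_addr//; lra.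
Qed.
End Recursions.

(** * One forward step *)

Section Step.
Context {R : realType} (V : hilbertType R) (A : V -> set V) (B : V -> V) (L : R).
Hypotheses (Amono : Defs.monotone A) (Bmono : monotone_map B) (Bcoco : cocoercive L B).
Variables (alpha rho : R) (g x w x' a' : V).
Hypotheses (alpha01 : 0 < alpha <= 1) (rho0 : 0 < rho)
  (small : rho * L <= 2 * (1 - alpha)).
Hypotheses (Ax' : A x' a')
  (step : x' + rho *: a' = (1 - alpha) *: x + alpha *: g - rho *: (B x - w)).

(** The only place where the step size is compared with L.  Multiplying by L,
rather than dividing, covers constant B (L = 0) as well. *)
Lemma cocoercive_step u v :
  rho * `|B u - B v| ^+ 2 <= 2 * (1 - alpha) * inner (u - v) (B u - B v).
Proof.
have := Bmono u v; have := Bcoco u v; rewrite (innerC (B u - B v)).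
set s := inner _ _ => c m.
apply: le_trans (_ : rho * (L * s) <= _); first by rewrite ler_pM2l.
by rewrite mulrA ler_wpM2r.
Qed.

(** The resolvent of A is nonexpansive, and so is the averaged forward operator
(1 - alpha) id - rho B up to the factor 1 - alpha; both are compared with their
values at theta. *)
Lemma step_norm theta a0 : A theta a0 ->
  `|x' - theta| <= (1 - alpha) * `|x - theta| + alpha * `|g - theta|
                   + rho * `|w - (a0 + B theta)|.
Proof.
move=> At; case/andP: alpha01 => a_gt0 a_le1.
pose d := (1 - alpha) *: (x - theta) - rho *: (B x - B theta).
pose r := d + alpha *: (g - theta) + rho *: (w - (a0 + B theta)).
have rE : r = (x' - theta) + rho *: (a' - a0).
  have -> : x' - theta + rho *: (a' - a0) = x' + rho *: a' - theta - rho *: a0.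
    by apply: inner_ext => v; rewrite !innerE; ring.
  by rewrite step; apply: inner_ext => v; rewrite /r /d !innerE; ring.
have xr : `|x' - theta| <= `|r|.
  have [->|n0] := eqVneq `|x' - theta| 0; first by [].
  have np : 0 < `|x' - theta| by rewrite lt0r n0 normr_ge0.
  rewrite -(ler_pM2l np) -expr2 -inner_sqr.
  apply: le_trans (_ : inner (x' - theta) r <= _).
    rewrite rE [leRHS]innerDr innerZr lerDl mulr_ge0 ?(ltW rho0)//; exact: Amono.
  by apply: le_trans (ler_norm _) _; exact: cauchy_schwarz.
have dx : `|d| <= (1 - alpha) * `|x - theta|.
  rewrite -[1 - alpha]ger0_norm ?subr_ge0// -normrZ.
  apply: ler_sqr_norm.
  rewrite /d; move: (x - theta) (B x - B theta) (cocoercive_step x theta) => e b.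
  rewrite -(inner_sqr b) !innerE (innerC b e) => h.
  have := ler_wpM2l (ltW rho0) h; lra.
apply: le_trans xr _; rewrite /r; apply: le_trans (ler_normD _ _) _.
rewrite normrZ gtr0_norm// lerD2r; apply: le_trans (ler_normD _ _) _.
by rewrite normrZ gtr0_norm// lerD2r.
Qed.

(** With D = x' - x, b = B x' - B x, Y = y - w and E = yh - w, the difference of
the two sides, multiplied by 2 alpha, is
  2 (1 - alpha) <D, y' - y> - rho |b|^2 + rho (1 - alpha) |E - Y|^2.
Monotonicity of A bounds <D, y' - y> below by <D, b>, and cocoercive_step
concludes. *)
Lemma step_ascent a y y' yh : A x a ->
  y = a + B x -> y' = a' + B x' -> yh = a' + B x ->
  rho / (2 * alpha) * (`|y' - w| ^+ 2 + alpha * `|yh - w| ^+ 2)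
     + (1 - alpha) * (inner (g - x) (y - w) - rho / (2 * alpha) * `|y - w| ^+ 2)
  <= inner (g - x') (y' - w).
Proof.
move=> Ax yE y'E yhE; case/andP: alpha01 => a_gt0 a_le1.
pose D := x' - x; pose b := B x' - B x; pose Y := y - w; pose E := yh - w.
have Dyy : inner D b <= inner D (E + b - Y).
  have -> : E + b - Y = b + (a' - a).
    by apply: inner_ext => v; rewrite /E /b /Y yE yhE !innerE; ring.
  by rewrite innerDr lerDl; exact: Amono.
have y'w : y' - w = E + b.
  by apply: inner_ext => v; rewrite /E /b y'E yhE !innerE; ring.
(* This is the definition of the step, solved for g. *)
have gx : g - x = alpha^-1 *: (D + rho *: E).
  have -> : D + rho *: E = (x' + rho *: a') - x + rho *: (B x - w).
    by apply: inner_ext => v; rewrite /D /E yhE !innerE; ring.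
  by rewrite step; apply: inner_ext => v; rewrite !innerE; field; rewrite lt0r_neq0.
have -> : g - x' = (g - x) - D by apply: inner_ext => v; rewrite /D !innerE; ring.
have -> : y - w = Y by [].
have -> : yh - w = E by [].
have := cocoercive_step x' x; rewrite -/D -/b.
rewrite y'w gx -!inner_sqr => {y'w gx yE y'E yhE}.
move: D b Y E Dyy => D b Y E Dyy h.
rewrite -(ler_pM2l (_ : 0 < 2 * alpha)) ?mulr_gt0//.
have EY0 : 0 <= inner (E - Y) (E - Y) by rewrite inner_sqr exprn_ge0.
set lhs := leLHS; set rhs := leRHS; rewrite -subr_ge0.
have -> : rhs - lhs = 2 * (1 - alpha) * inner D (E + b - Y) - rho * inner b b
   + rho * (1 - alpha) * inner (E - Y) (E - Y).
  rewrite /lhs /rhs !innerE (innerC b E) (innerC Y E).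
  by field; rewrite lt0r_neq0.
have : 0 <= rho * (1 - alpha) * inner (E - Y) (E - Y).
  by rewrite !mulr_ge0 ?subr_ge0 ?(ltW rho0).
have : 0 <= 2 * (1 - alpha) * (inner D (E + b - Y) - inner D b).
  by rewrite !mulr_ge0 ?subr_ge0.
lra.
Qed.
End Step.

(** * Asymptotics at one index *)

Lemma cocoercive_lipschitz (R : realType) (V : hilbertType R) (B : V -> V) (L : R) :
  0 <= L -> cocoercive L B -> forall u v, `|B u - B v| <= L * `|u - v|.
Proof.
move=> L0 Bc u v; have [->|n0] := eqVneq `|B u - B v| 0; first by rewrite mulr_ge0.
have np : 0 < `|B u - B v| by rewrite lt0r n0 normr_ge0.
rewrite -(ler_pM2l np) -expr2; apply: le_trans (Bc u v) _.
rewrite mulrCA; apply: ler_wpM2l => //.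
by apply: le_trans (ler_norm _) _; exact: cauchy_schwarz.
Qed.

(** The sequences below stand for the data of the algorithm at one index: g for
G_i z and w for w_i; rmin and rmax bound the step sizes. *)
Section IndexAsymptotics.
Context {R : realType} (V : hilbertType R) (B : V -> V) (L alpha rmin rmax : R).
Hypotheses (L0 : 0 <= L) (Bcoco : cocoercive L B).
Hypotheses (alpha01 : 0 < alpha <= 1) (rmin0 : 0 < rmin).
Variables (theta wh : V) (x y yh g w : nat -> V) (rho : nat -> R).
Hypothesis rho_bnd : forall k, rmin <= rho k <= rmax.
Hypothesis step_x : forall k,
  rho k.+1 *: (yh k.+1 - w k.+1) = (1 - alpha) *: x k + alpha *: g k.+1 - x k.+1.
Hypothesis step_y : forall k, y k.+1 = yh k.+1 - B (x k) + B (x k.+1).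
Hypothesis norm_test : forall k,
  `|x k.+1 - theta| <= (1 - alpha) * `|x k - theta| + alpha * `|g k.+1 - theta|
                       + rho k.+1 * `|w k.+1 - wh|.
Hypothesis ascent_test : forall k,
  rho k.+1 / (2 * alpha) * (`|y k.+1 - w k.+1| ^+ 2 + alpha * `|yh k.+1 - w k.+1| ^+ 2)
  + (1 - alpha) * (inner (g k.+1 - x k) (y k - w k.+1)
                   - rho k.+1 / (2 * alpha) * `|y k - w k.+1| ^+ 2)
  <= inner (g k.+1 - x k.+1) (y k.+1 - w k.+1).
(* The cap on the step size, freed of the quotient eta: the growth factor is
   1 + alpha |yh - w|^2 / |y - w|^2. *)
Hypothesis growth : forall k,
  rho k.+1 * `|y k - w k| ^+ 2
  <= rho k * (`|y k - w k| ^+ 2 + alpha * `|yh k - w k| ^+ 2).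
Variable M0 : R.
Hypotheses (g_bnd : forall k, `|g k| <= M0) (w_bnd : forall k, `|w k| <= M0).

Let rho_gt0 k : 0 < rho k.
Proof. by have /andP[h _] := rho_bnd k; exact: lt_le_trans h. Qed.

(** The norm test is a recursion of ratio 1 - alpha < 1 for |x - theta|; then y is
a Lipschitz function of bounded data, the division by rho being harmless since
rho >= rmin. *)
Lemma iterates_bounded : exists M, forall k, `|x k| <= M /\ `|y k| <= M.
Proof.
case/andP: alpha01 => a0 a1.
have M00 : 0 <= M0 by apply: le_trans (g_bnd 0).
have [M hM] : exists M, forall k, `|x k - theta| <= M.
  apply: (@bounded_recursion _ (1 - alpha)
     (alpha * (M0 + `|theta|) + rmax * (M0 + `|wh|))); first by apply/andP; lra.
  move=> k; apply: le_trans (norm_test k) _; rewrite -addrA lerD2l.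
  apply: lerD.
    rewrite ler_pM2l//; apply: le_trans (ler_normB _ _) _; by rewrite lerD2r.
  apply: ler_pM => //; [exact: ltW|by have /andP[] := rho_bnd k.+1|].
  by apply: le_trans (ler_normB _ _) _; rewrite lerD2r.
pose Mx := M + `|theta|.
have xM k : `|x k| <= Mx.
  by rewrite -[x k](subrK theta); apply: le_trans (ler_normD _ _) _; rewrite lerD2r.
have yM k : `|y k.+1| <= rmin^-1 * (2 * Mx + M0) + M0 + L * (2 * Mx).
  have yhM : `|yh k.+1 - w k.+1| <= rmin^-1 * (2 * Mx + M0).
    rewrite -ler_pdivrMl ?invr_gt0// invrK.
    apply: le_trans (_ : rho k.+1 * `|yh k.+1 - w k.+1| <= _).
      by apply: ler_wpM2r => //; have /andP[] := rho_bnd k.+1.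
    rewrite -[rho _]gtr0_norm// -normrZ step_x.
    apply: le_trans (ler_normB _ _) _.
    have := ler_normD ((1 - alpha) *: x k) (alpha *: g k.+1).
    rewrite !normrZ (gtr0_norm a0) ger0_norm ?subr_ge0//.
    have := xM k; have := xM k.+1; have := g_bnd k.+1.
    have := normr_ge0 (x k); have := normr_ge0 (g k.+1).
    set X := `|x k|; set G := `|g k.+1|; nra.
  have -> : y k.+1 = (yh k.+1 - w k.+1) + w k.+1 + (B (x k.+1) - B (x k)).
    by rewrite step_y subrK addrAC addrA.
  apply: le_trans (ler_normD _ _) _; apply: lerD.
    by apply: le_trans (ler_normD _ _) _; apply: lerD.
  apply: le_trans (cocoercive_lipschitz L0 Bcoco _ _) _; apply: ler_wpM2l => //.
  by apply: le_trans (ler_normB _ _) _; rewrite mulr_natl mulr2n lerD.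
exists (Num.max Mx (Num.max `|y 0| (rmin^-1 * (2 * Mx + M0) + M0 + L * (2 * Mx)))).
move=> k; rewrite !le_max xM; split=> //.
by case: k => [|k]; rewrite ?lexx ?yM !orbT.
Qed.

Hypothesis dg : `|g k.+1 - g k| @[k --> \oo] --> 0.
Hypothesis dw : `|w k.+1 - w k| @[k --> \oo] --> 0.

(** The quantity D k below satisfies D k.+1 >= (1 - alpha) D k - K d k, where d k is
the motion of (g, w) between k and k.+1: the ascent test relates the two up to
the replacement of (g k, w k) by (g k.+1, w k.+1), which costs K d k, and growth
absorbs the change of step size.  The error e is the negative part of D. *)
Lemma inner_lower_bound : exists2 e : nat -> R, e k @[k --> \oo] --> 0 &
  forall k, rmin / 2 * (`|y k - w k| ^+ 2 + `|yh k - w k| ^+ 2)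
            <= inner (g k - x k) (y k - w k) + e k.
Proof.
case/andP: alpha01 => a0 a1.
have [M1 xyM] := iterates_bounded.
pose M := Num.max M0 M1.
have xM k : `|x k| <= M by rewrite le_max (xyM k).1 orbT.
have yM k : `|y k| <= M by rewrite le_max (xyM k).2 orbT.
have gM k : `|g k| <= M by rewrite le_max g_bnd.
have wM k : `|w k| <= M by rewrite le_max w_bnd.
have M_ge0 : 0 <= M by apply: le_trans (xM 0).
pose phi k := inner (g k - x k) (y k - w k).
pose D k := phi k - rho k / (2 * alpha)
              * (`|y k - w k| ^+ 2 + alpha * `|yh k - w k| ^+ 2).
pose d k := `|g k.+1 - g k| + `|w k.+1 - w k|.
have r0 : 0 <= rmax by have /andP[_ h] := rho_bnd 0; apply: le_trans h; exact: ltW.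
(* phi varies by at most 2 M d, and the square of |y - w| by at most 4 M d. *)
pose K := 2 * M + rmax / (2 * alpha) * (4 * M).
have K0 : 0 <= K.
  by rewrite /K addr_ge0 ?mulr_ge0// invr_ge0 mulr_ge0// ltW.
have rec k : (1 - alpha) * D k - K * d k <= D k.+1.
  have b2 (u v : V) : `|u| <= M -> `|v| <= M -> `|u - v| <= 2 * M.
    move=> hu hv; apply: le_trans (ler_normB _ _) _; lra.
  have h1 : phi k - 2 * M * d k <= inner (g k.+1 - x k) (y k - w k.+1).
    rewrite lerBlDr -lerBlDl.
    have -> : phi k - inner (g k.+1 - x k) (y k - w k.+1)
       = - inner (g k.+1 - g k) (y k - w k.+1) + inner (g k - x k) (w k.+1 - w k).
      by rewrite /phi !innerE; ring.
    rewrite /d mulrDr; apply: lerD.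
      apply: le_trans (ler_norm _) _; rewrite normrN.
      apply: le_trans (cauchy_schwarz _ _) _; rewrite mulrC.
      by apply: ler_wpM2r => //; apply: b2.
    apply: le_trans (ler_norm _) _; apply: le_trans (cauchy_schwarz _ _) _.
    by apply: ler_wpM2r => //; apply: b2.
  have h2 : `|y k - w k.+1| ^+ 2 <= `|y k - w k| ^+ 2 + 4 * M * d k.
    have : `|y k - w k.+1| <= `|y k - w k| + d k.
      have -> : y k - w k.+1 = (y k - w k) + (w k - w k.+1) by rewrite addrA subrK.
      apply: le_trans (ler_normD _ _) _; rewrite lerD2l distrC /d.
      by rewrite lerDr.
    have d0 : 0 <= d k by rewrite addr_ge0.
    have := b2 _ _ (yM k) (wM k); have := b2 _ _ (yM k) (wM k.+1).
    have := normr_ge0 (y k - w k); have := normr_ge0 (y k - w k.+1).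
    set p := `|_ - w k.+1|; set q := `|_|; nra.
  have d0 : 0 <= d k by rewrite addr_ge0.
  have := ascent_test k; rewrite -/(phi k.+1) => h3.
  have ia : 0 < (2 * alpha)^-1 by rewrite invr_gt0 mulr_gt0.
  have rk := rho_gt0 k.+1.
  have h4 : rho k.+1 / (2 * alpha) * `|y k - w k.+1| ^+ 2
     <= rho k / (2 * alpha) * (`|y k - w k| ^+ 2 + alpha * `|yh k - w k| ^+ 2)
        + rmax / (2 * alpha) * (4 * M) * d k.
    apply: le_trans (_ : rho k.+1 / (2 * alpha) * (`|y k - w k| ^+ 2 + 4 * M * d k) <= _).
      by rewrite ler_pM2l// mulr_gt0.
    rewrite mulrDr; apply: lerD.
      by rewrite mulrAC [leRHS]mulrAC ler_pM2r.
    rewrite -[leRHS]mulrA; apply: ler_wpM2r; first by rewrite !mulr_ge0.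
    by rewrite ler_pM2r//; have /andP[] := rho_bnd k.+1.
  have h5 : D k - K * d k <= inner (g k.+1 - x k) (y k - w k.+1)
                   - rho k.+1 / (2 * alpha) * `|y k - w k.+1| ^+ 2.
    by rewrite /D /K; move: h1 h4; lra.
  have h6 : (1 - alpha) * (D k - K * d k) <= D k.+1.
    rewrite {2}/D lerBrDl; apply: le_trans h3; rewrite lerD2l.
    by apply: ler_wpM2l; rewrite ?subr_ge0.
  apply: le_trans h6; rewrite [leRHS]mulrBr lerD2l lerN2.
  rewrite -[leRHS]mul1r; apply: ler_wpM2r; last by lra.
  by rewrite mulr_ge0// addr_ge0// ?mulr_ge0// ltW.
have d_cvg : d k @[k --> \oo] --> 0.
  by rewrite -[0](addr0 0); apply: cvgD.
pose e k := Num.max 0 (- D k).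
exists e.
  apply: (@cvg0_recursion _ (1 - alpha) e (fun k => K * d k)).
  - by apply/andP; lra.
  - by move=> k; rewrite le_max lexx.
  - apply: nearW => k; rewrite /e ge_max; apply/andP; split.
      apply: addr_ge0; last by apply: mulr_ge0 => //; apply: addr_ge0.
      by apply: mulr_ge0; [lra | rewrite le_max lexx].
    have : - D k <= Num.max 0 (- D k) by rewrite le_max lexx orbT.
    move: (rec k); set m := Num.max _ _; move: (D k) (D k.+1) (K * d k) => D0 D1 Kd h1 h2.
    have : (1 - alpha) * - D0 <= (1 - alpha) * m by rewrite ler_wpM2l ?subr_ge0.
    lra.
  - rewrite -[0](mulr0 K); apply: cvgM => //; exact: cvg_cst.
move=> k; have : - D k <= e k by rewrite le_max lexx orbT.
rewrite /D -/(phi k) => h.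
have /andP[rk _] := rho_bnd k.
have sY := sqr_ge0 `|y k - w k|; have sYh := sqr_ge0 `|yh k - w k|.
suff : rmin / 2 * (`|y k - w k| ^+ 2 + `|yh k - w k| ^+ 2) <=
       rho k / (2 * alpha) * (`|y k - w k| ^+ 2 + alpha * `|yh k - w k| ^+ 2) by lra.
have -> : rho k / (2 * alpha) * (`|y k - w k| ^+ 2 + alpha * `|yh k - w k| ^+ 2)
   = rho k / 2 * (alpha^-1 * `|y k - w k| ^+ 2 + `|yh k - w k| ^+ 2).
  by field; rewrite lt0r_neq0.
have ai : 1 <= alpha^-1 by rewrite invf_ge1.
apply: ler_pM; [by rewrite divr_ge0 ?(ltW rmin0)|lra|lra|].
by rewrite lerD2r -[leLHS]mul1r ler_wpM2r.
Qed.

(** By step_x, x - g is contracted by 1 - alpha at each step, up to rho (yh - w)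
and the motion of g. *)
Lemma x_g_cvg : `|yh k - w k| @[k --> \oo] --> 0 -> `|x k - g k| @[k --> \oo] --> 0.
Proof.
case/andP: alpha01 => a0 a1 yhw.
apply: (@cvg0_recursion _ (1 - alpha) _
  (fun k => `|g k.+1 - g k| + rmax * `|yh k.+1 - w k.+1|)).
- by apply/andP; lra.
- by move=> k.
- apply: nearW => k.
  have -> : x k.+1 - g k.+1 = (1 - alpha) *: (x k - g k) - (1 - alpha) *: (g k.+1 - g k)
     - rho k.+1 *: (yh k.+1 - w k.+1).
    by rewrite step_x; apply: inner_ext => v; rewrite !innerE; ring.
  apply: le_trans (ler_normB _ _) _; rewrite addrA; apply: lerD; last first.
    rewrite normrZ gtr0_norm//; apply: ler_wpM2r => //.
    by have /andP[] := rho_bnd k.+1.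
  apply: le_trans (ler_normB _ _) _; rewrite !normrZ ger0_norm ?subr_ge0// lerD2l.
  by rewrite -[leRHS]mul1r; apply: ler_wpM2r => //; lra.
- rewrite -[0](addr0 0); apply: cvgD => //.
  rewrite -[0](mulr0 rmax); apply: cvgM; first exact: cvg_cst.
  by rewrite (cvg_shiftS (fun k => `|yh k - w k|)).
Qed.
End IndexAsymptotics.

(** * Identities in the product space and maximality *)

Lemma big_option (V : nmodType) (T : finType) (F : option T -> V) :
  \sum_(i : option T) F i = F None + \sum_(j : T) F (Some j).
Proof.
rewrite (bigD1 None)//=; congr (_ + _).
rewrite (@reindex_omap _ _ _ _ _ Some id)/=; last by case.
by apply: eq_bigl => j; rewrite eqxx.
Qed.

Section Operators.
Context {R : realType} (m : nat) (H0 : hilbertType R) (H : 'I_m -> hilbertType R).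
Variable P : problem H0 H.
Local Notation I := (option 'I_m).
Local Notation sp := (Defs.space H0 H).
Hypothesis Pok : problem_ok P.

Lemma linG_bounded j : bounded_operator (linG P j).
Proof. by case: Pok. Qed.

Lemma opA_max (i : I) : maximal_monotone (@opA _ _ _ _ P i).
Proof. by case: Pok. Qed.

Lemma opA_mono (i : I) : Defs.monotone (@opA _ _ _ _ P i).
Proof. by case: (opA_max i). Qed.

Lemma opB_mono (i : I) : monotone_map (@opB _ _ _ _ P i).
Proof. by case: Pok. Qed.

Lemma cstL_ge0 (i : I) : 0 <= cstL P i.
Proof. by case: Pok => _ _ /(_ i)[[/ltW//]|[->]]. Qed.

Lemma opB_coco (i : I) : cocoercive (cstL P i) (@opB _ _ _ _ P i).
Proof.
case: Pok => _ _ /(_ i)[[//]|[-> h]] _ _ x x'.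
by rewrite (h x x') subrr normr0 mul0r expr0n.
Qed.

(** The part of T_i contributed by A_i is dropped by monotonicity, which leaves the
variation of B_i to which cocoercivity applies. *)
Lemma opT_coco (i : I) x y x' y' : @opT _ _ _ _ P i x y -> @opT _ _ _ _ P i x' y' ->
  inner (x - x') (@opB _ _ _ _ P i x - @opB _ _ _ _ P i x') <= inner (x - x') (y - y').
Proof.
move=> [a Aa <-] [a' Aa' <-].
have -> : a + opB P x - (a' + opB P x') = (opB P x - opB P x') + (a - a').
  by apply: inner_ext => v; rewrite !innerE; ring.
by rewrite [leRHS]innerDr lerDl; exact: opA_mono.
Qed.

Lemma opT_mono (i : I) x y x' y' : @opT _ _ _ _ P i x y -> @opT _ _ _ _ P i x' y' ->
  0 <= inner (x - x') (y - y').
Proof. by move=> T1 T2; apply: le_trans (opT_coco T1 T2); exact: opB_mono. Qed.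

Lemma mapGB i : {morph mapG P i : z z' / z - z'}.
Proof. by case: i => [j|] z z' //=; rewrite linearB. Qed.

Lemma w_extB (w w' : forall j, H j) i :
  w_ext P (fun j => w j - w' j) i = w_ext P w i - w_ext P w' i.
Proof.
case: i => [j|] //=; rewrite /w_last -opprD -sumrB.
by congr (- _); apply: eq_bigr => j _; rewrite adjointB//; exact: linG_bounded.
Qed.

Lemma mapG_bounded i : exists2 M : R, 0 <= M & forall z, `|mapG P i z| <= M * `|z|.
Proof.
case: i => [j|] /=; last by exists 1 => // z; rewrite mul1r.
exact/bounded_operator_ge0/linG_bounded.
Qed.

Lemma w_last_bounded : exists2 M : 'I_m -> R, (forall j, 0 <= M j) &
  forall w, `|w_last P w| <= \sum_(j < m) M j * `|w j|.
Proof.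
pose M j := s2val (cid2 (bounded_operator_ge0 (linG_bounded j))).
have M0 j : 0 <= M j by rewrite /M; case: (cid2 _).
exists M => // w; rewrite /w_last normrN; apply: le_trans (ler_norm_sum _ _ _) _.
apply: ler_sum => j _; apply: adjoint_bounded => // x.
by rewrite /M; case: (cid2 _).
Qed.

Lemma sum_mapG_adjoint z (y : forall i, sp i) :
  \sum_(i : I) inner (mapG P i z) (y i)
  = inner z (\sum_(j < m) adjoint (linG P j) (y (Some j)) + y None).
Proof.
rewrite big_option innerDr addrC; congr (_ + _); rewrite inner_sumr.
by apply: eq_bigr => j _; rewrite adjointP//; exact: linG_bounded.
Qed.

(** The definition of w_last makes (G_i z)_i and (w_i)_i orthogonal.  This is what
makes the separating function affine. *)
Lemma sum_mapG_w_ext z w : \sum_(i : I) inner (mapG P i z) (w_ext P w i) = 0.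
Proof. by rewrite sum_mapG_adjoint /= /w_last subrr inner0r. Qed.

(** Moves the adjoints hidden in w_last to the other side, which makes the
directions u_j appear. *)
Lemma sum_w_ext (x : forall i, sp i) w :
  \sum_(i : I) inner (x i) (w_ext P w i)
  = \sum_(j < m) inner (w j) (x (Some j) - linG P j (x None)).
Proof.
rewrite big_option /= /w_last innerNr inner_sumr -sumrN -big_split/=.
apply: eq_bigr => j _; rewrite innerDr innerNr addrC innerC; congr (_ - _).
by rewrite -adjointP 1?innerC//; exact: linG_bounded.
Qed.

Lemma solution_setP z w :
  solution_set P (z, w) <-> forall i, @opT _ _ _ _ P i (mapG P i z) (w_ext P w i).
Proof.
split=> [[h1 h2] [j|]//|h]; split => [j|]; [exact: (h (Some j))|exact: (h None)].
Qed.

Lemma solution_exists : exists z w, solution_set P (z, w).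
Proof.
case: Pok => _ _ _ _ [z [t [tT t0]]].
exists z, (fun j => t (Some j)); apply/solution_setP => -[j|]; first exact: (tT (Some j)).
suff -> : w_ext P (fun j => t (Some j)) None = t None by exact: (tT None).
move/esym: t0; rewrite big_option /= adjoint_id => /eqP.
by rewrite addr_eq0 /w_last => /eqP ->.
Qed.

(** Adding the pair (u, v) to the graph of A keeps it monotone. *)
Lemma maximal_mem (V : hilbertType R) (A : V -> set V) u v : maximal_monotone A ->
  (forall x a, A x a -> 0 <= inner (u - x) (v - a)) -> A u v.
Proof.
move=> [Am Amax] h.
pose A' x := A x `|` [set a | x = u /\ a = v].
have <- : A' = A.
  apply: Amax => [x x' a a'|x a Axa]; last by left.
  move=> [Axa|[-> ->]] [Axa'|[-> ->]].
  - exact: Am.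
  - rewrite -(opprB u) -(opprB v) innerNl innerNr opprK; exact: h.
  - exact: h.
  - by rewrite subrr inner0l.
by right.
Qed.

(** The product of the A_i is maximal: at an index where (u i, v i) is not in the
graph there is a pair with a negative product, and at every other index the pair
(u i, v i) itself contributes 0. *)
Lemma maximal_product u v :
  (forall x a, (forall i, @opA _ _ _ _ P i (x i) (a i)) ->
     0 <= \sum_(i : I) inner (u i - x i) (v i - a i)) ->
  forall i, @opA _ _ _ _ P i (u i) (v i).
Proof.
move=> h i0; apply: contrapT => nA.
have ex i : exists xa : sp i * sp i, [/\ @opA _ _ _ _ P i xa.1 xa.2,
    inner (u i - xa.1) (v i - xa.2) <= 0 &
    ~ @opA _ _ _ _ P i (u i) (v i) -> inner (u i - xa.1) (v i - xa.2) < 0].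
  have [Ai|nAi] := pselect (@opA _ _ _ _ P i (u i) (v i)).
    by exists (u i, v i); split => //=; rewrite subrr inner0l.
  suff [xa [Axa lt0]] : exists xa : sp i * sp i, @opA _ _ _ _ P i xa.1 xa.2 /\
      inner (u i - xa.1) (v i - xa.2) < 0 by exists xa; split => //; exact: ltW.
  apply: contrapT => ne; apply: nAi; apply: maximal_mem (opA_max i) _ => x a Axa.
  by rewrite leNgt; apply/negP => lt0; apply: ne; exists (x, a).
pose xa i := sval (cid (ex i)).
have xaP i := svalP (cid (ex i)).
have := h (fun i => (xa i).1) (fun i => (xa i).2) (fun i => let: And3 h _ _ := xaP i in h).
rewrite leNgt => /negP; apply.
rewrite (bigD1 i0)//=; have [_ _ /(_ nA) lt0] := xaP i0.
rewrite -[ltRHS]addr0; apply: ltr_leD => //.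
by apply: sumr_le0 => i _; have [] := xaP i.
Qed.
End Operators.

(** * The steps of the algorithm *)

Section Steps.
Context {R : realType} (m : nat) (H0 : hilbertType R) (H : 'I_m -> hilbertType R).
Variables (P : problem H0 H) (par : parameters H0 H) (tr : trace H0 H).
Local Notation I := (option 'I_m).
Local Notation sp := (Defs.space H0 H).
Local Notation A i := (@opA _ _ _ _ P i).
Local Notation B i := (@opB _ _ _ _ P i).
Local Notation T i := (@opT _ _ _ _ P i).
Local Notation G i k := (mapG P i (zs tr k)).
Local Notation W i k := (w_ext P (ws tr k) i).
Hypotheses (Pok : problem_ok P) (parok : parameters_ok P par).

Lemma alp01 i : 0 < alp par i <= 1.
Proof. by case: parok => _ _ /(_ i)[]. Qed.

(** Unfolds the resolvent into an element a' of A_i x'.  In terms of a' both y' and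
y_hat are a' plus a value of B_i, at the new and at the old point respectively. *)
Lemma one_forwardP k i rho x' y' : 0 < rho -> @one_forward _ _ _ _ P par tr k i rho x' y' ->
  exists a', [/\ A i x' a', y' = a' + B i x',
    x' + rho *: a' = (1 - alp par i) *: xs tr k.-1 i + alp par i *: G i k
                      - rho *: (B i (xs tr k.-1 i) - W i k)
    & y_hat P par tr k rho x' = a' + B i (xs tr k.-1 i)].
Proof.
move=> r0 [res ->]; set t := (X in resolvent _ _ X) in res *.
have : resolvent rho (A i) t x' by rewrite res.
move=> [a' Aa' tE]; have ra : rho^-1 *: (t - x') = a'.
  by rewrite tE addrC addKr scalerA mulVf ?lt0r_neq0// scale1r.
exists a'; split; rewrite ?ra//; rewrite -ra /y_hat /t.
by apply: inner_ext => v; rewrite !innerE; field; rewrite lt0r_neq0.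
Qed.

Definition small_step i rho := rho * cstL P i <= 2 * (1 - alp par i).

Lemma small_step_norm k i rho x' y' theta wh : 0 < rho -> small_step i rho ->
  @one_forward _ _ _ _ P par tr k i rho x' y' -> T i theta wh ->
  `|x' - theta| <= (1 - alp par i) * `|xs tr k.-1 i - theta|
       + alp par i * `|G i k - theta| + rho * `|W i k - wh|.
Proof.
move=> r0 sm fwd [a0 At <-]; have [a' [Aa' _ st _]] := one_forwardP r0 fwd.
exact: (step_norm (opA_mono Pok (i:=i)) (opB_mono Pok (i:=i)) (opB_coco Pok (i:=i))
   (alp01 i) r0 sm Aa' st At).
Qed.

Lemma small_step_test k i rho x' y' : 0 < rho -> small_step i rho ->
  @one_forward _ _ _ _ P par tr k i rho x' y' -> T i (xs tr k.-1 i) (ys tr k.-1 i) ->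
  rho / (2 * alp par i) * (`|y' - W i k| ^+ 2
      + alp par i * `|y_hat P par tr k rho x' - W i k| ^+ 2)
  + (1 - alp par i) * (inner (G i k - xs tr k.-1 i) (ys tr k.-1 i - W i k)
                       - rho / (2 * alp par i) * `|ys tr k.-1 i - W i k| ^+ 2)
  <= inner (G i k - x') (y' - W i k).
Proof.
move=> r0 sm fwd [a At yE]; have [a' [Aa' y'E st yhE]] := one_forwardP r0 fwd.
exact: (step_ascent (opA_mono Pok (i:=i)) (opB_mono Pok (i:=i)) (opB_coco Pok (i:=i))
   (alp01 i) r0 sm Aa' st At (esym yE) y'E yhE).
Qed.

(** The value 1 when L_i = 0 is arbitrary: there every step size is small. *)
Definition crit_rho i : R :=
  if 0 < cstL P i then 2 * (1 - alp par i) / cstL P i else 1.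

Lemma crit_rho_gt0 i : 0 < crit_rho i.
Proof.
rewrite /crit_rho; case: ifPn => // L0; rewrite divr_gt0// mulr_gt0// subr_gt0.
by case: parok => _ _ /(_ i)[_ ->].
Qed.

Lemma crit_rhoP i rho : 0 < rho -> rho <= crit_rho i \/ ~ 0 < cstL P i -> small_step i rho.
Proof.
rewrite /small_step /crit_rho => r0; case: ifPn => L0.
  by case=> [|/(_ isT)//]; rewrite ler_pdivlMr.
move=> _; have -> : cstL P i = 0 by apply/eqP; rewrite eq_le (cstL_ge0 Pok) leNgt L0.
by rewrite mulr0 mulr_ge0// subr_ge0; case/andP: (alp01 i).
Qed.

(** Trial step sizes shrink geometrically, so one of them is small and passes the
tests; the first one that passes is either the initial trial, which is at least
the previous step size, or delta times a trial that failed and thus exceeds the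
critical value. *)
Lemma backtracking_stepP k i : i \in btB par ->
  0 < rhos tr k.-1 i -> T i (xs tr k.-1 i) (ys tr k.-1 i) ->
  backtracking_step P par tr k i ->
  [/\ @one_forward _ _ _ _ P par tr k i (rhos tr k i) (xs tr k i) (ys tr k i),
      @backtrack_test _ _ _ _ P par tr k i (rhos tr k i) (xs tr k i) (ys tr k i),
      Num.min (rhos tr k.-1 i) (del par * crit_rho i) <= rhos tr k i,
      ((rhos tr k i)%:E <= mine ((1 + (alp par i)%:E * etas tr k.-1 i) * (rhos tr k.-1 i)%:E)
              (rhohat par)%:E)%E
    & ys tr k i <> W i k -> etas tr k i
        = (`|y_hat P par tr k (rhos tr k i) (xs tr k i) - W i k| ^+ 2
           / `|ys tr k i - W i k| ^+ 2)%:E].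
Proof.
move=> iB r0 Txy [rt [xt [yt [rt0 rtle rtS ofj pass]]]].
have [_ /andP[d0 d1] _ /(_ i iB)[_ _ _ That _] _] := parok.
have rtE j : rt j = del par ^+ j * rt 0%N.
  by elim: j => [|j IH]; [rewrite mul1r | rewrite rtS IH exprS mulrA].
have rt00 : 0 < rt 0%N by exact: lt_le_trans rt0.
have rt_gt0 j : 0 < rt j by rewrite rtE mulr_gt0// exprn_gt0.
have small_pass j : small_step i (rt j) ->
    @backtrack_test _ _ _ _ P par tr k i (rt j) (xt j) (yt j).
  move=> sm; split; first exact: (small_step_norm _ _ (ofj j)).
  exact: (small_step_test _ _ (ofj j)).
have ex_small : exists j, small_step i (rt j).
  have := @cvg_geometric R (rt 0%N) (del par); rewrite ger0_norm ?(ltW d0)// => /(_ d1).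
  move=> /cvgrPdist_le /(_ _ (crit_rho_gt0 i)) [j _ /(_ j (leqnn j))].
  rewrite /geometric/= sub0r normrN => h; exists j; apply: crit_rhoP => //; left.
  by rewrite rtE mulrC; apply: le_trans (ler_norm _) h.
have ex : exists j, `[< @backtrack_test _ _ _ _ P par tr k i (rt j) (xt j) (yt j) >].
  by have [j /small_pass h] := ex_small; exists j; apply/asboolP.
case: (ex_minnP ex) => j /asboolP testj minj.
have [|->->-> _ eta] := pass j testj.
  by move=> l lj /asboolP /minj; rewrite leqNgt lj.
have rtj_le : rt j <= rt 0%N.
  by rewrite rtE ler_piMl ?(ltW rt00)// exprn_ile1 ?(ltW d0) ?(ltW d1).
split => //; last by apply: le_trans rtle; rewrite lee_fin.
case: j => [|j] in testj minj {rtj_le eta} *; first by rewrite ge_min rt0.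
have nsm : ~ small_step i (rt j).
  by move=> /small_pass /asboolP /minj; rewrite ltnn.
rewrite ge_min rtS; apply/orP; right; rewrite ler_pM2l// leNgt; apply/negP => lt.
by apply: nsm; apply: crit_rhoP => //; left; exact: ltW.
Qed.

Definition used_rho k i := if i \in btB par then rhos tr k i else rhofix par i.

Definition low_rho i := if i \in btB par then Num.min (rho0 par i) (del par * crit_rho i)
  else rhofix par i.

Lemma low_rho_gt0 i : 0 < low_rho i.
Proof.
rewrite /low_rho; case: ifPn => iB; last by case: parok => _ _ _ _ /(_ i iB)[].
have [_ /andP[d0 _] _ /(_ i iB)[r0 _ _ _ _] _] := parok.
by rewrite lt_min r0 mulr_gt0// crit_rho_gt0.
Qed.

Section Run.
Variable N : nat.
Hypotheses (init : initialized par tr)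
  (proc : forall k, (1 <= k <= N)%N -> processing_step P par tr k).

(** The graph membership of (x_i, y_i) at iteration k - 1 is what makes the ascent
test pass at iteration k, so the two facts are proved together. *)
Lemma backtracking_invariant k i : (k <= N)%N -> i \in btB par ->
  T i (xs tr k i) (ys tr k i) /\ low_rho i <= rhos tr k i.
Proof.
move=> + iB; elim: k => [_|k IH kN].
  have [_ _ x0E /(_ i iB)[-> -> _]] := init.
  have [_ _ _ /(_ i iB)[_ _ _ _ T0] _] := parok.
  by rewrite x0E; split=> //; rewrite /low_rho iB ge_min lexx.
have [Tk lk] := IH (ltnW kN).
have := proc (k := k.+1); rewrite ltnS leq0n kN => /(_ isT i); rewrite iB => st.
have rk : 0 < rhos tr k i by apply: lt_le_trans lk; exact: low_rho_gt0.
have [fwd _ rlow _ _] := backtracking_stepP (k := k.+1) iB rk Tk st.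
have lk' : low_rho i <= rhos tr k.+1 i.
  apply: le_trans rlow; rewrite le_min lk /low_rho iB.
  by rewrite ge_min lexx orbT.
split=> //; have [|a' [Aa' -> _ _]] := one_forwardP _ fwd; last by exists a'.
by apply: lt_le_trans lk'; exact: low_rho_gt0.
Qed.

Lemma backtracking_run k i : (1 <= k <= N)%N -> i \in btB par ->
  [/\ @one_forward _ _ _ _ P par tr k i (rhos tr k i) (xs tr k i) (ys tr k i),
      @backtrack_test _ _ _ _ P par tr k i (rhos tr k i) (xs tr k i) (ys tr k i),
      Num.min (rhos tr k.-1 i) (del par * crit_rho i) <= rhos tr k i,
      ((rhos tr k i)%:E <= mine ((1 + (alp par i)%:E * etas tr k.-1 i) * (rhos tr k.-1 i)%:E)
              (rhohat par)%:E)%E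
    & ys tr k i <> W i k -> etas tr k i
        = (`|y_hat P par tr k (rhos tr k i) (xs tr k i) - W i k| ^+ 2
           / `|ys tr k i - W i k| ^+ 2)%:E].
Proof.
move=> kN iB; have := proc kN i; rewrite iB.
have k1N : (k.-1 <= N)%N by case/andP: kN => _; apply: leq_trans; exact: leq_pred.
have [Tk lk] := backtracking_invariant k1N iB.
by apply: backtracking_stepP => //; apply: lt_le_trans lk; exact: low_rho_gt0.
Qed.

Lemma used_rho_bounds k i : (1 <= k <= N)%N -> low_rho i <= used_rho k i <= rhohat par.
Proof.
move=> kN; rewrite /used_rho; case: ifPn => iB; last first.
  by rewrite /low_rho (negbTE iB) lexx; case: parok => _ _ _ _ /(_ i iB)[].
have [_ _ _ + _] := backtracking_run kN iB; rewrite le_min lee_fin => /andP[_ ->].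
by rewrite andbT; apply: (backtracking_invariant _ iB).2; case/andP: kN.
Qed.

Lemma used_one_forward k i : (1 <= k <= N)%N ->
  @one_forward _ _ _ _ P par tr k i (used_rho k i) (xs tr k i) (ys tr k i).
Proof.
move=> kN; rewrite /used_rho; case: ifPn => iB; first by have [] := backtracking_run kN iB.
by have := proc kN i; rewrite (negbTE iB).
Qed.

Lemma run_step k i : (1 <= k <= N)%N ->
  exists a', [/\ A i (xs tr k i) a', ys tr k i = a' + B i (xs tr k i),
    xs tr k i + used_rho k i *: a' =
       (1 - alp par i) *: xs tr k.-1 i + alp par i *: G i k
                      - used_rho k i *: (B i (xs tr k.-1 i) - W i k)
    & y_hat P par tr k (used_rho k i) (xs tr k i) = a' + B i (xs tr k.-1 i)].
Proof.
move=> kN; apply: one_forwardP (used_one_forward i kN).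
by have /andP[h _] := used_rho_bounds i kN; apply: lt_le_trans h; exact: low_rho_gt0.
Qed.

Lemma run_graph k i : (1 <= k <= N)%N -> T i (xs tr k i) (ys tr k i).
Proof. by move=> /(run_step i)[a' [Aa' -> _ _]]; exists a'. Qed.

Lemma used_rho_gt0 k i : (1 <= k <= N)%N -> 0 < used_rho k i.
Proof.
by move=> kN; have /andP[h _] := used_rho_bounds i kN; apply: lt_le_trans h; exact: low_rho_gt0.
Qed.

Lemma fixed_small i : i \notin btB par -> small_step i (rhofix par i).
Proof.
move=> iB; have [_ _ _ _ /(_ i iB)[r0 _ rL]] := parok.
apply: crit_rhoP => //; have [L0|L0] := boolP (0 < cstL P i); last by right; exact/negP.
by left; rewrite /crit_rho L0; exact: rL.
Qed.

(** With backtracking this is the first test, whose reference point is prescribed;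
without, any point of the graph will do. *)
Lemma run_norm i theta wh : (i \in btB par -> theta = thetahat par i /\ wh = what par i) ->
  T i theta wh -> forall k, (1 <= k <= N)%N ->
  `|xs tr k i - theta| <= (1 - alp par i) * `|xs tr k.-1 i - theta|
       + alp par i * `|G i k - theta| + used_rho k i * `|W i k - wh|.
Proof.
move=> thE Tth k kN; have [iB|iB] := boolP (i \in btB par).
  have [-> ->] := thE iB; rewrite /used_rho iB.
  by have [_ [] ] := backtracking_run kN iB.
have := used_one_forward i kN; rewrite /used_rho (negbTE iB) => fwd.
apply: (small_step_norm _ _ fwd) => //; last exact: fixed_small.
by have [_ _ _ _ /(_ i iB)[]] := parok.
Qed.

(** Iteration 1 is excluded because, without backtracking, the initial y_i need not
be in the image of T_i. *)
Lemma run_ascent k i : (1 < k <= N)%N ->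
  used_rho k i / (2 * alp par i) * (`|ys tr k i - W i k| ^+ 2
      + alp par i * `|y_hat P par tr k (used_rho k i) (xs tr k i) - W i k| ^+ 2)
  + (1 - alp par i) * (inner (G i k - xs tr k.-1 i) (ys tr k.-1 i - W i k)
                       - used_rho k i / (2 * alp par i) * `|ys tr k.-1 i - W i k| ^+ 2)
  <= inner (G i k - xs tr k i) (ys tr k i - W i k).
Proof.
move=> /andP[k1 kN]; have kN1 : (1 <= k <= N)%N by rewrite kN ltnW.
have [iB|iB] := boolP (i \in btB par).
  by rewrite /used_rho iB; have [_ [] ] := backtracking_run kN1 iB.
have := used_one_forward i kN1; rewrite /used_rho (negbTE iB) => fwd.
apply: (small_step_test _ _ fwd) => //.
- by have [_ _ _ _ /(_ i iB)[]] := parok.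
- exact: fixed_small.
- apply: run_graph; case: k k1 kN {kN1 fwd} => // k /=; rewrite ltnS => -> /ltnW //.
Qed.

(** If y_i = w_i the left-hand side is 0, whatever value eta takes. *)
Lemma run_growth k i : (1 <= k < N)%N ->
  used_rho k.+1 i * `|ys tr k i - W i k| ^+ 2
  <= used_rho k i * (`|ys tr k i - W i k| ^+ 2
      + alp par i * `|y_hat P par tr k (used_rho k i) (xs tr k i) - W i k| ^+ 2).
Proof.
move=> /andP[k1 kN]; have kN1 : (1 <= k <= N)%N by rewrite k1 ltnW.
have rk := used_rho_gt0 i kN1.
have a0 : 0 <= alp par i by case/andP: (alp01 i) => /ltW.
have [->|ne] := pselect (ys tr k i = W i k).
  by rewrite subrr normr0 expr0n /= mulr0 add0r !mulr_ge0// ?exprn_ge0// ltW.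
have n0 : 0 < `|ys tr k i - W i k| ^+ 2.
  by rewrite exprn_gt0// normr_gt0 subr_eq0; apply/eqP.
move: rk; rewrite /used_rho; case: ifPn => iB rk; last first.
  by rewrite ler_pM2l// lerDl mulr_ge0// exprn_ge0.
have [_ _ _ _ /(_ ne) eta] := backtracking_run kN1 iB.
have [_ _ _ + _] := backtracking_run (k := k.+1) kN iB; rewrite le_min => /andP[+ _] /=.
rewrite eta -EFinM lee_fin => h.
rewrite -ler_pdivlMr//; apply: le_trans h _.
rewrite le_eqVlt; apply/orP; left; apply/eqP; field.
by rewrite -sqrf_eq0 lt0r_neq0.
Qed.
End Run.

(** When pi_K = 0, u = 0 says that x_i = G_i x_n and v = 0 that y_n is the last
component attached to (y_i); membership in the graphs of the T_i does the rest. *)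
Lemma terminates_solution K : terminates_at P par tr K ->
  solution_set P (zs tr K.+1, ws tr K.+1).
Proof.
move=> [K1 init procK [stK pi0 [zE wE]]].
have proc k : (1 <= k <= K)%N -> processing_step P par tr k.
  move=> /andP[k1]; rewrite leq_eqVlt => /orP[/eqP ->//|kK].
  by have [] := procK k; rewrite ?k1.
have T_ i : T i (xs tr K i) (ys tr K i) by apply: (run_graph init proc); rewrite K1 leqnn.
have gi0 : 0 < (gam par)^-1 by rewrite invr_gt0; case: parok.
have s0 : 0 <= \sum_(j < m) `|dir_u P tr K j| ^+ 2 by apply: sumr_ge0 => j _; rewrite exprn_ge0.
have v0 : 0 <= (gam par)^-1 * `|dir_v P tr K| ^+ 2 by rewrite mulr_ge0 ?exprn_ge0// ltW.
move/eqP: pi0; rewrite paddr_eq0// mulf_eq0 (gt_eqF gi0)/= => /andP[u0].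
rewrite sqrf_eq0 normr_eq0 => /eqP vE.
have uE j : dir_u P tr K j = 0.
  move: u0; rewrite psumr_eq0 => [/allP/(_ j (mem_index_enum _))|j' _]; last by rewrite exprn_ge0.
  by rewrite sqrf_eq0 normr_eq0 => /eqP.
split => [j|] /=.
  rewrite zE wE; move/eqP: (uE j); rewrite subr_eq0 => /eqP <-.
  exact: (T_ (Some j)).
rewrite zE; suff -> : w_last P (ws tr K.+1) = ys tr K None by exact: (T_ None).
move/eqP: vE; rewrite /dir_v addrC addr_eq0 => /eqP ->.
by congr (- _); apply: eq_bigr => j _; rewrite wE.
Qed.
End Steps.

(** * Fejer monotonicity *)

Section InfiniteRun.
Context {R : realType} (m : nat) (H0 : hilbertType R) (H : 'I_m -> hilbertType R).
Variables (P : problem H0 H) (par : parameters H0 H) (tr : trace H0 H).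
Local Notation I := (option 'I_m).
Local Notation sp := (Defs.space H0 H).
Local Notation A i := (@opA _ _ _ _ P i).
Local Notation B i := (@opB _ _ _ _ P i).
Local Notation T i := (@opT _ _ _ _ P i).
Local Notation G i k := (mapG P i (zs tr k)).
Local Notation W i k := (w_ext P (ws tr k) i).
Hypotheses (Pok : problem_ok P) (parok : parameters_ok P par)
  (run : runs_forever P par tr).

Lemma gam_gt0 : 0 < gam par. Proof. by case: parok. Qed.

Lemma run_proc N k : (1 <= k <= N)%N -> processing_step P par tr k.
Proof. by case: run => _ h /andP[/h[]]. Qed.

(** Affine in (z, w), although its terms are products (sepE): its nonpositive
half-space contains the solutions and is the target of the projection step. *)
Definition sep k (z : H0) (w : forall j, H j) : R :=
  \sum_(i : I) inner (mapG P i z - xs tr k i) (ys tr k i - w_ext P w i).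

Lemma sepE k z w : sep k z w = inner z (dir_v P tr k)
   + \sum_(j < m) inner (w j) (dir_u P tr k j)
   - \sum_(i : I) inner (xs tr k i) (ys tr k i).
Proof.
have -> : \sum_(j < m) inner (w j) (dir_u P tr k j)
    = \sum_(i : I) inner (xs tr k i) (w_ext P w i) by rewrite sum_w_ext.
have -> : inner z (dir_v P tr k) = \sum_(i : I) inner (mapG P i z) (ys tr k i).
  by rewrite sum_mapG_adjoint.
rewrite -[RHS]subr0 -[X in _ = _ - X](sum_mapG_w_ext Pok z w).
rewrite -big_split/= -!sumrB; apply: eq_bigr => i _.
by rewrite !innerE; ring.
Qed.

(** Each term is minus a product of differences of two pairs in the graph of T_i. *)
Lemma sep_solution k z w : (1 <= k)%N -> solution_set P (z, w) -> sep k z w <= 0.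
Proof.
move=> k1 /solution_setP sol; apply: sumr_le0 => i _.
have Tk : T i (xs tr k i) (ys tr k i).
  by apply: (run_graph Pok parok run.1 (N := k) (@run_proc k)); rewrite k1 leqnn.
by rewrite -oppr_ge0 -innerNr opprB; exact: (opT_mono Pok (sol i) Tk).
Qed.

(** The squared distance of the iterate to (z, w) in the metric for which the
projection step is orthogonal. *)
Definition dist2 k (z : H0) (w : forall j, H j) : R :=
  gam par * `|zs tr k - z| ^+ 2 + \sum_(j < m) `|ws tr k j - w j| ^+ 2.

Lemma residual_gt0 k : (1 <= k)%N -> 0 < pi_ P par tr k.
Proof.
move=> k1; have [_ /eqP pn _] := run.2 k k1; rewrite lt0r pn /pi_ addr_ge0//.
  by apply: sumr_ge0 => j _; rewrite exprn_ge0.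
by rewrite mulr_ge0 ?exprn_ge0// ltW// invr_gt0 gam_gt0.
Qed.

Lemma tauE k : (1 <= k)%N ->
  tau P par tr k * pi_ P par tr k = Num.max 0 (sep k (zs tr k) (ws tr k)).
Proof.
move=> k1; rewrite sepE /tau mulrAC mulVf ?mul1r//.
by rewrite lt0r_neq0// residual_gt0.
Qed.

(** The decrease of the squared distance is 2 tau s - tau^2 pi, where s, the
difference of the values of sep at the iterate and at the solution, is at least
the value at the iterate; and tau pi is the positive part of that value. *)
Lemma fejer_monotone k z w : (1 <= k)%N -> solution_set P (z, w) ->
  dist2 k.+1 z w + tau P par tr k ^+ 2 * pi_ P par tr k <= dist2 k z w.
Proof.
move=> k1 sol; have [_ _ [zE wE]] := run.2 k k1.
set t := tau P par tr k in zE wE *.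
pose s := sep k (zs tr k) (ws tr k) - sep k z w.
have g0 := gam_gt0.
have hE : dist2 k.+1 z w = dist2 k z w - 2 * t * s + t ^+ 2 * pi_ P par tr k.
  have -> : s = inner (zs tr k - z) (dir_v P tr k)
     + \sum_(j < m) inner (ws tr k j - w j) (dir_u P tr k j).
    rewrite /s !sepE.
    under [in RHS]eq_bigr do rewrite innerDl innerNl.
    by rewrite big_split/= sumrN !innerE; ring.
  rewrite /dist2 /pi_ zE.
  have -> : \sum_(j < m) `|ws tr k.+1 j - w j| ^+ 2 = \sum_(j < m) `|ws tr k j - w j| ^+ 2
     - 2 * t * (\sum_(j < m) inner (ws tr k j - w j) (dir_u P tr k j))
     + t ^+ 2 * \sum_(j < m) `|dir_u P tr k j| ^+ 2.
    rewrite !mulr_sumr -sumrB -big_split/=; apply: eq_bigr => j _.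
    have -> : ws tr k.+1 j - w j = (ws tr k j - w j) - t *: dir_u P tr k j by rewrite wE addrAC.
    move: (ws tr k j - w j) (dir_u P tr k j) => a u.
    by rewrite -!inner_sqr !innerE (innerC u a); ring.
  have -> : zs tr k - ((gam par)^-1 * t) *: dir_v P tr k - z
     = (zs tr k - z) - ((gam par)^-1 * t) *: dir_v P tr k by rewrite addrAC.
  move: (zs tr k - z) (dir_v P tr k) => a v.
  rewrite -[in LHS](inner_sqr (a - _)) -!(inner_sqr a) -!(inner_sqr v) !innerE (innerC v a).
  by field; rewrite lt0r_neq0.
have s_ge : sep k (zs tr k) (ws tr k) <= s by rewrite /s lerBrDr gerDl sep_solution.
have := tauE k1; rewrite -/t => tE.
suff : t ^+ 2 * pi_ P par tr k <= t * s by rewrite hE; lra.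
have t0 : 0 <= t by rewrite /t /tau mulr_ge0 ?le_max ?lexx// invr_ge0 ltW// residual_gt0.
rewrite expr2 -mulrA tE.
have [s0|s0] := leP (sep k (zs tr k) (ws tr k)) 0; last by apply: ler_wpM2l.
move: tE; rewrite max_l// mulr0 => /eqP;
rewrite mulf_eq0 (gt_eqF (residual_gt0 k1)) orbF => /eqP ->.
by rewrite mul0r.
Qed.

Lemma dist2_ge0 k z w : 0 <= dist2 k z w.
Proof.
rewrite /dist2 addr_ge0 ?mulr_ge0 ?exprn_ge0 ?(ltW gam_gt0)//.
by apply: sumr_ge0 => j _; rewrite exprn_ge0.
Qed.

Lemma dist2_cvg z w : solution_set P (z, w) -> cvg (dist2 k z w @[k --> \oo]).
Proof.
move=> sol; suff : cvg (dist2 k.+1 z w @[k --> \oo]).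
  by move=> /cvg_ex[l hl]; apply/cvg_ex; exists l; rewrite -(cvg_shiftS (fun k => dist2 k z w)).
apply: (@nonincreasing_is_cvgn _ (fun k => dist2 k.+1 z w)).
  apply/nonincreasing_seqP => k.
  have := fejer_monotone (ltn0Sn k) sol; apply: le_trans; rewrite lerDl mulr_ge0 ?sqr_ge0//.
  by rewrite ltW// residual_gt0.
by exists 0 => _ [k _ <-]; exact: dist2_ge0.
Qed.

Lemma tau_cvg : tau P par tr k.+1 ^+ 2 * pi_ P par tr k.+1 @[k --> \oo] --> 0.
Proof.
have [z [w sol]] := solution_exists Pok.
have /cvg_ex[l hl] := dist2_cvg sol.
apply: (@cvg0_dominated _ _ _ _ _ (fun k => dist2 k.+1 z w - dist2 k.+2 z w)).
  move=> k; rewrite mulr_ge0 ?sqr_ge0 ?(ltW (residual_gt0 _))//=.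
  by have := fejer_monotone (ltn0Sn k) sol; lra.
have h1 : dist2 k.+1 z w @[k --> \oo] --> l by rewrite (cvg_shiftS (fun k => dist2 k z w)).
have h2 : dist2 k.+2 z w @[k --> \oo] --> l by rewrite (cvg_shiftS (fun k => dist2 k.+1 z w)).
by rewrite -(subrr l); apply: cvgB.
Qed.

Lemma dist2_bounded z w : solution_set P (z, w) ->
  exists M, forall k, (1 <= k)%N -> dist2 k z w <= M.
Proof.
move=> sol; exists (dist2 1 z w); elim=> [//|[//|k] IH _].
apply: le_trans (IH isT); have := fejer_monotone (ltn0Sn k) sol; apply: le_trans.
by rewrite lerDl mulr_ge0 ?sqr_ge0// ltW// residual_gt0.
Qed.

Lemma zs_bounded : exists M, forall k, (1 <= k)%N -> `|zs tr k| <= M.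
Proof.
have [z [w sol]] := solution_exists Pok; have [M hM] := dist2_bounded sol.
exists ((gam par)^-1 * M + 1 + `|z|) => k k1.
rewrite -[zs tr k](subrK z); apply: le_trans (ler_normD _ _) _; rewrite lerD2r.
apply: norm_le_sqr; rewrite ler_pdivlMl ?gam_gt0//; apply: le_trans (hM k k1).
by rewrite lerDl sumr_ge0// => j _; rewrite exprn_ge0.
Qed.

Lemma ws_bounded j : exists M, forall k, (1 <= k)%N -> `|ws tr k j| <= M.
Proof.
have [z [w sol]] := solution_exists Pok; have [M hM] := dist2_bounded sol.
exists (M + 1 + `|w j|) => k k1.
rewrite -[ws tr k j](subrK (w j)); apply: le_trans (ler_normD _ _) _; rewrite lerD2r.
apply: norm_le_sqr; apply: le_trans (hM k k1).
rewrite /dist2 (bigD1 j)//= addrCA lerDl addr_ge0 ?sumr_ge0 ?mulr_ge0 ?exprn_ge0 ?(ltW gam_gt0) //.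
Qed.

Lemma G_bounded i : exists M, forall k, (1 <= k)%N -> `|G i k| <= M.
Proof.
have [M hM] := zs_bounded; have [C C0 hC] := mapG_bounded Pok i.
by exists (C * M) => k k1; apply: le_trans (hC _) _; rewrite ler_wpM2l// hM.
Qed.

Lemma W_bounded i : exists M, forall k, (1 <= k)%N -> `|W i k| <= M.
Proof.
case: i => [j|] /=; first exact: ws_bounded.
have [C C0 hC] := w_last_bounded Pok.
pose M j := sval (cid (ws_bounded j)).
exists (\sum_(j < m) C j * M j) => k k1; apply: le_trans (hC _) _.
apply: ler_sum => j _; rewrite ler_wpM2l//.
by rewrite /M; case: (cid _) => ? /= ->.
Qed.

Lemma dzs_cvg : `|zs tr k.+2 - zs tr k.+1| @[k --> \oo] --> 0.
Proof.
apply: cvg0_sqr.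
apply: (@cvg0_dominated _ _ _ _ _
  (fun k => (gam par)^-1 * (tau P par tr k.+1 ^+ 2 * pi_ P par tr k.+1))).
  move=> k; rewrite exprn_ge0//=; have [_ _ [-> _]] := run.2 k.+1 isT.
  rewrite addrAC subrr add0r normrN normrZ exprMn real_normK ?num_real// exprMn.
  move: (tau P par tr k.+1) => t.
  rewrite [leLHS](_ : _ = (gam par)^-1 *
    (t ^+ 2 * ((gam par)^-1 * `|dir_v P tr k.+1| ^+ 2))); last by ring.
  rewrite ler_pM2l ?invr_gt0 ?gam_gt0//; apply: ler_wpM2l; first exact: sqr_ge0.
  by rewrite /pi_ lerDr sumr_ge0// => j _; rewrite exprn_ge0.
by rewrite -[0](mulr0 (gam par)^-1); apply: cvgM; [exact: cvg_cst|exact: tau_cvg].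
Qed.

Lemma dws_cvg j : `|ws tr k.+2 j - ws tr k.+1 j| @[k --> \oo] --> 0.
Proof.
apply: cvg0_sqr; apply: cvg0_dominated tau_cvg => k.
rewrite exprn_ge0//=; have [_ _ [_ ->]] := run.2 k.+1 isT.
rewrite addrAC subrr add0r normrN normrZ exprMn real_normK ?num_real//.
rewrite ler_wpM2l ?sqr_ge0// /pi_ (bigD1 j)//= -addrA lerDl addr_ge0//.
  by rewrite sumr_ge0// => j' _; rewrite exprn_ge0.
by rewrite mulr_ge0 ?exprn_ge0// invr_ge0 ltW// gam_gt0.
Qed.

Lemma dG_cvg i : `|G i k.+2 - G i k.+1| @[k --> \oo] --> 0.
Proof.
have [C C0 hC] := mapG_bounded Pok i.
apply: (@cvg0_dominated _ _ _ _ _ (fun k => C * `|zs tr k.+2 - zs tr k.+1|)).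
  by move=> k; rewrite -mapGB hC normr_ge0.
by rewrite -[0](mulr0 C); apply: cvgM; [exact: cvg_cst|exact: dzs_cvg].
Qed.

Lemma dW_cvg i : `|W i k.+2 - W i k.+1| @[k --> \oo] --> 0.
Proof.
case: i => [j|] /=; first exact: dws_cvg.
have [C C0 hC] := w_last_bounded Pok.
apply: (@cvg0_dominated _ _ _ _ _ (fun k => \sum_(j < m) C j * `|ws tr k.+2 j - ws tr k.+1 j|)).
  move=> k; rewrite normr_ge0/=; have := w_extB Pok (ws tr k.+2) (ws tr k.+1) None.
  by move=> /= <-; exact: hC.
apply: cvg_sum0 => j.
by rewrite -[0](mulr0 (C j)); apply: cvgM; [exact: cvg_cst|exact: dws_cvg].
Qed.

Local Notation yh k i := (y_hat P par tr k (used_rho par tr k i) (xs tr k i)).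

(** Applies the analysis at one index to the sequences started at iteration 1, so
that all consecutive pairs satisfy the ascent and growth inequalities. *)
Lemma index_asymptotics i :
  [/\ exists M, forall k, (1 <= k)%N -> `|xs tr k i| <= M /\ `|ys tr k i| <= M,
   (exists c : R, 0 < c /\ exists2 e : nat -> R, e k @[k --> \oo] --> 0 &
     forall k, c * (`|ys tr k.+1 i - W i k.+1| ^+ 2 + `|yh k.+1 i - W i k.+1| ^+ 2)
       <= inner (G i k.+1 - xs tr k.+1 i) (ys tr k.+1 i - W i k.+1) + e k)
   & `|yh k.+1 i - W i k.+1| @[k --> \oo] --> 0 ->
     `|xs tr k.+1 i - G i k.+1| @[k --> \oo] --> 0].
Proof.
have [theta [wh [thE Tth]]] : exists theta wh : sp i,
    (i \in btB par -> theta = thetahat par i /\ wh = what par i) /\ T i theta wh.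
  have [iB|iB] := boolP (i \in btB par).
    have [_ _ _ /(_ i iB)[_ _ _ Th _] _] := parok.
    by exists (thetahat par i), (what par i).
  have [z [w /solution_setP sol]] := solution_exists Pok.
  by exists (mapG P i z), (w_ext P w i).
have [M1 hM1] := G_bounded i; have [M2 hM2] := W_bounded i.
pose M0 := Num.max M1 M2.
have gM k : `|G i k.+1| <= M0 by rewrite le_max hM1.
have wM k : `|W i k.+1| <= M0 by rewrite le_max hM2 ?orbT.
have init := run.1.
have proc N := @run_proc N.
have kk k : (1 <= k.+1 <= k.+1)%N by rewrite leqnn.
have rb k := used_rho_bounds Pok parok init (proc k.+1) i (kk k).
have st k : xs tr k.+1 i = (1 - alp par i) *: xs tr k i + alp par i *: G i k.+1
       - used_rho par tr k.+1 i *: (yh k.+1 i - W i k.+1).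
  have r0 := used_rho_gt0 Pok parok init (proc k.+1) i (kk k).
  rewrite /y_hat addrK scalerA mulfV ?lt0r_neq0// scale1r.
  by apply: inner_ext => v; rewrite !innerE; ring.
have sx k : used_rho par tr k.+2 i *: (yh k.+2 i - W i k.+2)
    = (1 - alp par i) *: xs tr k.+1 i + alp par i *: G i k.+2 - xs tr k.+2 i.
  by rewrite [X in _ = _ - X]st; apply: inner_ext => v; rewrite !innerE; ring.
have sy k : ys tr k.+2 i = yh k.+2 i - B i (xs tr k.+1 i) + B i (xs tr k.+2 i).
  have [a' [_ -> _ ->]] := run_step Pok parok init (proc k.+2) i (kk k.+1).
  by rewrite addrK.
have nt k : `|xs tr k.+2 i - theta| <= (1 - alp par i) * `|xs tr k.+1 i - theta|
    + alp par i * `|G i k.+2 - theta| + used_rho par tr k.+2 i * `|W i k.+2 - wh|.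
  exact: (run_norm Pok parok init (proc k.+2) thE Tth (kk k.+1)).
have asc k := run_ascent Pok parok init (proc k.+2) (k := k.+2) i ltac:(by rewrite leqnn).
have gr k := run_growth Pok parok init (proc k.+2) (k := k.+1) i ltac:(by rewrite leqnn).
have L0 := cstL_ge0 Pok i.
have Bc := opB_coco Pok (i := i).
have a01 := alp01 parok i.
have l0 := low_rho_gt0 parok i.
have [xM lb xg] : [/\ exists M, forall k, `|xs tr k.+1 i| <= M /\ `|ys tr k.+1 i| <= M,
   (exists2 e : nat -> R, e k @[k --> \oo] --> 0 &
     forall k, low_rho P par i / 2 *
         (`|ys tr k.+1 i - W i k.+1| ^+ 2 + `|yh k.+1 i - W i k.+1| ^+ 2)
       <= inner (G i k.+1 - xs tr k.+1 i) (ys tr k.+1 i - W i k.+1) + e k)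
   & `|yh k.+1 i - W i k.+1| @[k --> \oo] --> 0 ->
     `|xs tr k.+1 i - G i k.+1| @[k --> \oo] --> 0].
  split.
  - exact: (@iterates_bounded _ _ (B i) (cstL P i) _ _ _ L0 Bc a01 l0 theta wh
      (fun k => xs tr k.+1 i) (fun k => ys tr k.+1 i) (fun k => yh k.+1 i)
      (fun k => G i k.+1) (fun k => W i k.+1) _ rb sx sy nt M0).
  - exact: (@inner_lower_bound _ _ (B i) (cstL P i) _ _ _ L0 Bc a01 l0 theta wh
      (fun k => xs tr k.+1 i) (fun k => ys tr k.+1 i) (fun k => yh k.+1 i)
      (fun k => G i k.+1) (fun k => W i k.+1) _ rb sx sy nt asc gr M0 gM wM
      (dG_cvg i) (dW_cvg i)).
  - exact: (@x_g_cvg _ _ _ _ _ a01 l0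
      (fun k => xs tr k.+1 i) (fun k => yh k.+1 i)
      (fun k => G i k.+1) (fun k => W i k.+1) _ rb sx (dG_cvg i)).
split => //.
  by have [M hM] := xM; exists M; case.
by exists (low_rho P par i / 2); split => //; rewrite divr_gt0.
Qed.
End InfiniteRun.

(** * Vanishing residuals and weak cluster points *)

Section WeakStrong.
Context {R : realType} {T : Type} (F : set_system T) {FF : ProperFilter F}.

Lemma cvg0_inner (V : hilbertType R) (u v : T -> V) M :
  `|u t| @[t --> F] --> 0 -> (forall t, `|v t| <= M) ->
  inner (u t) (v t) @[t --> F] --> 0.
Proof.
move=> u0 vM; apply: (cvg_dominated (e := fun t => `|u t| * M)).
  apply: nearW => t; rewrite subr0; apply: le_trans (cauchy_schwarz _ _) _.
  exact: ler_wpM2l.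
by rewrite -[X in _ --> X](mul0r M); apply: cvgM => //; exact: cvg_cst.
Qed.

Lemma weak_perturbation (V : hilbertType R) (u g : T -> V) h (l : R) :
  `|u t - g t| @[t --> F] --> 0 -> inner (g t) h @[t --> F] --> l ->
  inner (u t) h @[t --> F] --> l.
Proof.
move=> ug gl; rewrite (_ : (fun t => _) = (fun t => inner (u t - g t) h + inner (g t) h)).
  by apply: cvg0Dl => //; apply: (cvg0_inner (M := `|h|)).
by apply/funext => t; rewrite innerDl innerNl subrK.
Qed.

Lemma inner_diff (V : hilbertType R) (x y g w a b : V) :
  inner (x - a) (y - b) - inner (g - a) (w - b)
  = inner (x - g) (y - b) + inner (y - w) (g - a).
Proof. by rewrite !innerE (innerC y g) (innerC y a) (innerC w g) (innerC w a); ring. Qed.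
End WeakStrong.

(** In this section all sequences are shifted by one: the iterations start at 1. *)
Section Limits.
Context {R : realType} (m : nat) (H0 : hilbertType R) (H : 'I_m -> hilbertType R).
Variables (P : problem H0 H) (par : parameters H0 H) (tr : trace H0 H).
Local Notation I := (option 'I_m).
Local Notation sp := (Defs.space H0 H).
Local Notation A i := (@opA _ _ _ _ P i).
Local Notation B i := (@opB _ _ _ _ P i).
Local Notation T i := (@opT _ _ _ _ P i).
Local Notation G i k := (mapG P i (zs tr k.+1)).
Local Notation W i k := (w_ext P (ws tr k.+1) i).
Local Notation Xs i k := (xs tr k.+1 i).
Local Notation Ys i k := (ys tr k.+1 i).
Hypotheses (Pok : problem_ok P) (parok : parameters_ok P par)
  (run : runs_forever P par tr).

Lemma XY_bounded i : exists M, forall k, `|Xs i k| <= M /\ `|Ys i k| <= M.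
Proof. by have [[M hM] _ _] := index_asymptotics Pok parok run i; exists M => k; exact: hM. Qed.

Lemma pi_bounded : exists M, forall k, pi_ P par tr k.+1 <= M.
Proof.
pose M i := sval (cid (XY_bounded i)).
have xM i k : `|Xs i k| <= M i by rewrite /M; case: (cid _) => ? /= /(_ k)[].
have yM i k : `|Ys i k| <= M i by rewrite /M; case: (cid _) => ? /= /(_ k)[].
have [C C0 hC] := w_last_bounded Pok.
pose D j := s2val (cid2 (mapG_bounded Pok (Some j))).
have D0 j : 0 <= D j by rewrite /D; case: (cid2 _).
have hD j z : `|linG P j z| <= D j * `|z| by rewrite /D; case: (cid2 _) => ? /= _; exact.
pose Mv := \sum_(j < m) C j * M (Some j) + M None.
exists (\sum_(j < m) (M (Some j) + D j * M None) ^+ 2 + (gam par)^-1 * Mv ^+ 2) => k.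
have g0 : 0 < (gam par)^-1 by rewrite invr_gt0; case: parok.
apply: lerD.
  apply: ler_sum => j _.
  have du : `|dir_u P tr k.+1 j| <= M (Some j) + D j * M None.
    apply: le_trans (ler_normB _ _) _; apply: lerD; first exact: (xM (Some j)).
    by apply: le_trans (hD _ _) _; apply: ler_wpM2l => //; exact: (xM None).
  by rewrite lerXn2r ?nnegrE// (le_trans _ du).
rewrite ler_pM2l//.
have dv : `|dir_v P tr k.+1| <= Mv.
  have -> : dir_v P tr k.+1 = Ys None k - w_last P (fun j => Ys (Some j) k).
    by rewrite /dir_v /w_last opprK addrC.
  apply: le_trans (ler_normB _ _) _; rewrite addrC; apply: lerD; last exact: (yM None).
  apply: le_trans (hC _) _; apply: ler_sum => j _; apply: ler_wpM2l => //.
  exact: (yM (Some j)).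
by rewrite lerXn2r ?nnegrE// (le_trans _ dv).
Qed.

(** The square of the positive part of sep is (tau^2 pi) pi, where the first factor
tends to 0 and the second is bounded. *)
Lemma sep_cvg : Num.max 0 (sep P tr k.+1 (zs tr k.+1) (ws tr k.+1)) @[k --> \oo] --> 0.
Proof.
have [M hM] := pi_bounded; apply: cvg0_sqr.
apply: (@cvg0_dominated _ _ _ _ _ (fun k => tau P par tr k.+1 ^+ 2 * pi_ P par tr k.+1 * M)).
  move=> k; rewrite sqr_ge0 -(tauE Pok parok run)//= exprMn [(pi_ _ _ _ _) ^+ 2]expr2 mulrA.
  rewrite ler_wpM2l// mulr_ge0 ?sqr_ge0// ltW//; exact: residual_gt0.
by rewrite -[X in _ --> X](mul0r M); apply: cvgM; [exact: tau_cvg|exact: cvg_cst].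
Qed.

(** The lower bounds at the various indices add up to a lower bound of sep, whose
positive part vanishes; as all of them are nonnegative up to vanishing errors,
each one tends to 0. *)
Lemma residuals_cvg i : `|Xs i k - G i k| @[k --> \oo] --> 0 /\
  `|Ys i k - W i k| @[k --> \oo] --> 0.
Proof.
pose yh k i := y_hat P par tr k (used_rho par tr k i) (xs tr k i).
have ex i' : exists ce : R * (nat -> R), [/\ 0 < ce.1, ce.2 k @[k --> \oo] --> 0 &
   forall k, ce.1 * (`|Ys i' k - W i' k| ^+ 2 + `|yh k.+1 i' - W i' k| ^+ 2)
       <= inner (G i' k - Xs i' k) (Ys i' k - W i' k) + ce.2 k].
  by have [_ [c [c0 [e e0 he]]] _] := index_asymptotics Pok parok run i'; exists (c, e).
pose ce i := sval (cid (ex i)); have ceP i' := svalP (cid (ex i')).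
have tot : Num.max 0 (sep P tr k.+1 (zs tr k.+1) (ws tr k.+1)) + \sum_(i' : I) (ce i').2 k
    @[k --> \oo] --> 0.
  apply: cvg0D; first exact: sep_cvg.
  by apply: cvg_sum0 => i'; have [] := ceP i'.
have bnd k : (ce i).1 * (`|Ys i k - W i k| ^+ 2 + `|yh k.+1 i - W i k| ^+ 2)
   <= Num.max 0 (sep P tr k.+1 (zs tr k.+1) (ws tr k.+1)) + \sum_(i' : I) (ce i').2 k.
  apply: (@le_trans _ _ (sep P tr k.+1 (zs tr k.+1) (ws tr k.+1) + \sum_(i' : I) (ce i').2 k)).
    rewrite /sep -big_split/= (bigD1 i)//=.
    have [_ _ /(_ k) h] := ceP i; apply: le_trans h _; rewrite lerDl sumr_ge0// => i' _.
    have [c0 _ /(_ k)] := ceP i'; apply: le_trans.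
    by rewrite mulr_ge0 ?(ltW c0)// addr_ge0 ?exprn_ge0.
  by rewrite lerD2r le_max lexx orbT.
have [c0 _ _] := ceP i; rewrite -/(ce i) in c0.
have sum0 : `|Ys i k - W i k| ^+ 2 + `|yh k.+1 i - W i k| ^+ 2 @[k --> \oo] --> 0.
  apply: (@cvg0_dominated _ _ _ _ _ (fun k => (ce i).1^-1 *
    (Num.max 0 (sep P tr k.+1 (zs tr k.+1) (ws tr k.+1)) + \sum_(i' : I) (ce i').2 k))).
    by move=> k; rewrite addr_ge0 ?exprn_ge0//= ler_pdivlMl.
  by rewrite -[X in _ --> X](mulr0 (ce i).1^-1); apply: cvgM; [exact: cvg_cst|].
split.
  have [_ _ h] := index_asymptotics Pok parok run i; apply: h.
  apply: cvg0_sqr; apply: cvg0_dominated sum0 => k.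
  by rewrite exprn_ge0//= /yh lerDr exprn_ge0.
by apply: cvg0_sqr; apply: cvg0_dominated sum0 => k; rewrite exprn_ge0//= lerDl exprn_ge0.
Qed.

Lemma X_G_cvg i : `|Xs i k - G i k| @[k --> \oo] --> 0.
Proof. by have [] := residuals_cvg i. Qed.

Lemma Y_W_cvg i : `|Ys i k - W i k| @[k --> \oo] --> 0.
Proof. by have [] := residuals_cvg i. Qed.

Lemma mapG_iterates_bounded i : exists M, forall k, `|G i k| <= M.
Proof. by have [M hM] := G_bounded Pok parok run i; exists M => k; exact: hM. Qed.

(** Replacing (x_i, y_i) by (G_i z, w_i) in a pairing costs a term that vanishes by
residuals_cvg.  Summed over i, the pairing of (G_i z, w_i) has no quadratic part
(sum_mapG_w_ext), so weak convergence is enough to pass to the limit. *)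
Lemma pairing_cvg i (a b : sp i) :
  inner (Xs i k - a) (Ys i k - b) - inner (G i k - a) (W i k - b) @[k --> \oo] --> 0.
Proof.
have [M hM] := XY_bounded i; have [M' hM'] := mapG_iterates_bounded i.
under eq_cvg do rewrite inner_diff.
apply: cvg0D.
  apply: (@cvg0_inner _ _ _ _ _ _ _ (M + `|b|)); first exact: X_G_cvg.
  by move=> k; apply: le_trans (ler_normB _ _) _; rewrite lerD2r; have [] := hM k.
apply: (@cvg0_inner _ _ _ _ _ _ _ (M' + `|a|)); first exact: Y_W_cvg.
by move=> k; apply: le_trans (ler_normB _ _) _; rewrite lerD2r.
Qed.

Lemma XY_graph i k : T i (Xs i k) (Ys i k).
Proof.
apply: (run_graph Pok parok run.1 (N := k.+1) (@run_proc _ _ _ _ _ _ _ run k.+1)).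
by rewrite /= leqnn.
Qed.

(** Cocoercivity bounds |B_i x_i - B_i G_i z|^2 by L_i times the pairing of
(x_i, y_i) with the solution, and the pairings of all indices add up to a
vanishing quantity. *)
Lemma B_cvg i z w : solution_set P (z, w) ->
  `|B i (Xs i k) - B i (mapG P i z)| @[k --> \oo] --> 0.
Proof.
move=> /solution_setP sol.
pose s k := \sum_(i' : I) inner (Xs i' k - mapG P i' z) (Ys i' k - w_ext P w i').
have s0 : s k @[k --> \oo] --> 0.
  have orth k : \sum_(i' : I) inner (G i' k - mapG P i' z) (W i' k - w_ext P w i') = 0.
    rewrite -[RHS](sum_mapG_w_ext Pok (zs tr k.+1 - z) (fun j => ws tr k.+1 j - w j)).
    by apply: eq_bigr => i' _; rewrite mapGB w_extB.
  under eq_cvg => k do rewrite -[s k]subr0 -(orth k) -sumrB.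
  by apply: cvg_sum0 => i'; exact: pairing_cvg.
apply: cvg0_sqr; apply: (@cvg0_dominated _ _ _ _ _ (fun k => cstL P i * s k)).
  move=> k; rewrite exprn_ge0//=; apply: le_trans (opB_coco Pok _ _) _.
  apply: ler_wpM2l; first exact: cstL_ge0.
  rewrite innerC; apply: le_trans (opT_coco Pok (XY_graph i k) (sol i)) _.
  rewrite /s (bigD1 i)//= lerDl sumr_ge0// => i' _.
  exact: (opT_mono Pok (XY_graph i' k) (sol i')).
by rewrite -[X in _ --> X](mulr0 (cstL P i)); apply: cvgM => //; exact: cvg_cst.
Qed.

Section WeakCluster.
Variables (U : set_system nat) (zb : H0) (wb : forall j, H j).
Context {UF : ProperFilter U}.
Hypotheses (FU : \oo `<=` U)
  (zbP : forall h, inner (zs tr k.+1) h @[k --> U] --> inner zb h)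
  (wbP : forall j h, inner (ws tr k.+1 j) h @[k --> U] --> inner (wb j) h).

Lemma G_weak i h : inner (G i k) h @[k --> U] --> inner (mapG P i zb) h.
Proof.
case: i h => [j|] h /=; last exact: zbP.
have E := adjointP (linG_bounded Pok j).
by rewrite E; under eq_cvg do rewrite E; exact: zbP.
Qed.

Lemma W_weak i h : inner (W i k) h @[k --> U] --> inner (w_ext P wb i) h.
Proof.
case: i h => [j|] h /=; first exact: wbP.
have E (w : forall j, H j) : inner (w_last P w) h = - \sum_(j < m) inner (w j) (linG P j h).
  rewrite /w_last innerNl inner_suml; congr (- _); apply: eq_bigr => j _.
  by rewrite innerC -adjointP 1?innerC//; exact: linG_bounded.
rewrite E; under eq_cvg do rewrite E.
by apply: cvgN; apply: cvg_sumr => j; exact: wbP.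
Qed.

Lemma X_weak i h : inner (Xs i k) h @[k --> U] --> inner (mapG P i zb) h.
Proof.
apply: (weak_perturbation (g := fun k => G i k)); last exact: G_weak.
by apply: cvg_sub_filter FU _; exact: X_G_cvg.
Qed.

Lemma Y_weak i h : inner (Ys i k) h @[k --> U] --> inner (w_ext P wb i) h.
Proof.
apply: (weak_perturbation (g := fun k => W i k)); last exact: W_weak.
by apply: cvg_sub_filter FU _; exact: Y_W_cvg.
Qed.

(** Let b_i be the strong limit of B_i x_i.  Since y_i - B_i x_i is in A_i x_i, the
monotonicity inequalities of A_i pass to the limit and give w_i - b_i in
A_i G_i z by maximality.  Cocoercivity between x_i and G_i z, a product of a
strongly and a weakly convergent sequence, then gives b_i = B_i G_i z. *)
Lemma weak_cluster_solution : solution_set P (zb, wb).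
Proof.
have [z [w sol]] := solution_exists Pok.
pose b i := B i (mapG P i z).
have Bb i : `|B i (Xs i k) - b i| @[k --> \oo] --> 0 by exact: B_cvg sol.
have [Mx hMx] : exists M : I -> R, forall i k, `|Xs i k| <= M i.
  exists (fun i => sval (cid (XY_bounded i))) => i k.
  by case: (cid _) => ? /= /(_ k)[].
have inA : forall i, A i (mapG P i zb) (w_ext P wb i - b i).
  apply: (maximal_product Pok) => x a Axa.
  (* The product of A_i at (x_i, y_i - B_i x_i) and (x, a) is the pairing of
     (x_i, y_i) with (x, a + b) minus a term that vanishes with B_i x_i - b_i. *)
  have lim1 : \sum_(i : I) (inner (Xs i k - x i) (Ys i k - (a i + b i))
      - inner (G i k - x i) (W i k - (a i + b i))) @[k --> U] --> 0.
    by apply: cvg_sub_filter FU _; apply: cvg_sum0 => i; exact: pairing_cvg.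
  have lim2 : \sum_(i : I) inner (G i k - x i) (W i k - (a i + b i)) @[k --> U] -->
      \sum_(i : I) inner (mapG P i zb - x i) (w_ext P wb i - (a i + b i)).
    have E zz ww : \sum_(i : I) inner (mapG P i zz - x i) (w_ext P ww i - (a i + b i))
       = \sum_(i : I) (inner (x i) (a i + b i) - inner (mapG P i zz) (a i + b i)
                        - inner (w_ext P ww i) (x i)).
      rewrite -[RHS]add0r -[X in _ = X + _](sum_mapG_w_ext Pok zz ww) -big_split/=.
      apply: eq_bigr => i _.
      by rewrite !innerE (innerC (w_ext _ _ _)); ring.
    rewrite E; under eq_cvg do rewrite E.
    apply: cvg_sumr => i; apply: cvgB; last exact: W_weak.
    by apply: cvgB; [exact: cvg_cst|exact: G_weak].
  have lim3 : \sum_(i : I) inner (B i (Xs i k) - b i) (Xs i k - x i) @[k --> U] --> 0.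
    apply: cvg_sub_filter FU _; apply: cvg_sum0 => i.
    apply: (@cvg0_inner _ _ _ _ _ _ _ (Mx i + `|x i|)); first exact: Bb.
    by move=> k; apply: le_trans (ler_normB _ _) _; rewrite lerD2r.
  have -> : \sum_(i : I) inner (mapG P i zb - x i) (w_ext P wb i - b i - a i)
     = \sum_(i : I) inner (mapG P i zb - x i) (w_ext P wb i - (a i + b i)).
    by apply: eq_bigr => i _; rewrite opprD addrA addrAC.
  have := ler_cvg_to (cvg_cst (0 : R)) (cvgD (cvgB lim1 lim3) lim2).
  rewrite subr0 add0r; apply.
  apply: nearW => k; rewrite !fctE -sumrB -big_split/=; apply: sumr_ge0 => i _.
  have [a' Aa' yE] := XY_graph i k.
  have := opA_mono Pok Aa' (Axa i); rewrite -yE /b !innerE.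
  rewrite (innerC (B i (Xs i k))) (innerC (B i (Xs i k))) (innerC (B i _) (Xs i k))
    (innerC (B i _) (x i)).
  lra.
pose b' i := B i (mapG P i zb).
have bE i : B i (mapG P i zb) = b i.
  have lim1 : inner (B i (Xs i k) - b i) (Xs i k - mapG P i zb)
      + inner (b i - b' i) (Xs i k - mapG P i zb) @[k --> U] --> 0.
    apply: cvg0D.
      apply: cvg_sub_filter FU _.
      apply: (@cvg0_inner _ _ _ _ _ _ _ (Mx i + `|mapG P i zb|)); first exact: Bb.
      by move=> k; apply: le_trans (ler_normB _ _) _; rewrite lerD2r.
    under eq_cvg do rewrite innerC innerDl innerNl.
    have := cvgB (@X_weak i (b i - b' i)) (cvg_cst (inner (mapG P i zb) (b i - b' i))).
    by rewrite subrr; apply.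
  have lim2 : `|B i (Xs i k) - b' i| ^+ 2 @[k --> U] --> `|b i - b' i| ^+ 2.
    have : `|B i (Xs i k) - b' i| @[k --> U] --> `|b i - b' i|.
      apply: cvg_norm; apply: cvgB; last exact: cvg_cst.
      by apply/cvg_distP; apply: cvg_sub_filter FU _; exact: Bb.
    by move=> h; rewrite expr2; under eq_cvg do rewrite expr2; apply: cvgM.
  have lim3 : cstL P i * (inner (B i (Xs i k) - b i) (Xs i k - mapG P i zb)
      + inner (b i - b' i) (Xs i k - mapG P i zb)) @[k --> U] --> 0.
    by rewrite -[X in _ --> X](mulr0 (cstL P i)); apply: cvgM => //; exact: cvg_cst.
  have : `|b i - b' i| ^+ 2 <= 0.
    apply: (ler_cvg_to lim2 lim3); apply: nearW => k /=.
    rewrite -innerDl addrA subrK; exact: opB_coco.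
  rewrite real_exprn_even_le0 ?num_real// normr_eq0 subr_eq0 => /eqP ->.
  by [].
apply/solution_setP => i; exists (w_ext P wb i - b i); first exact: inA.
by rewrite bE subrK.
Qed.
End WeakCluster.
End Limits.

(** * Weak convergence of the iterates *)

Section Opial.
Context {R : realType} (m : nat) (H0 : hilbertType R) (H : 'I_m -> hilbertType R).
Variables (P : problem H0 H) (par : parameters H0 H) (tr : trace H0 H).
Hypotheses (Pok : problem_ok P) (parok : parameters_ok P par)
  (run : runs_forever P par tr).

Definition weak_limit_along (U : set_system nat) (z : H0) (w : forall j, H j) :=
  (forall h, inner (zs tr k.+1) h @[k --> U] --> inner z h) /\
  (forall j h, inner (ws tr k.+1 j) h @[k --> U] --> inner (w j) h).

Lemma weak_limit_exists (U : set_system nat) : UltraFilter U ->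
  exists z w, weak_limit_along U z w.
Proof.
move=> UU; have [Mz hz] := zs_bounded Pok parok run.
have [z zP] : exists z, forall h, inner (zs tr k.+1) h @[k --> U] --> inner z h.
  by apply: (ultra_weak_limit (M := Mz)); apply: nearW => k; exact: hz.
have ex j : exists w, forall h, inner (ws tr k.+1 j) h @[k --> U] --> inner w h.
  have [M hw] := ws_bounded Pok parok run j.
  by apply: (ultra_weak_limit (M := M)); apply: nearW => k; exact: hw.
exists z, (fun j => sval (cid (ex j))); split=> // j h.
exact: (svalP (cid (ex j))).
Qed.

(** The argument of Opial.  Both limits are solutions, so the squared distances to
both converge along the whole sequence; so does their difference, which is affine
in the iterate.  Its limits along U and U' therefore coincide, and their
difference is the squared distance of the two limits. *)
Lemma weak_limits_agree (U U' : set_system nat) z w z' w' :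
  ProperFilter U -> ProperFilter U' -> \oo `<=` U -> \oo `<=` U' ->
  weak_limit_along U z w -> weak_limit_along U' z' w' ->
  z = z' /\ forall j, w j = w' j.
Proof.
move=> PU PU' sU sU' [zl wl] [zl' wl'].
have sol : solution_set P (z, w) by exact (weak_cluster_solution Pok parok run sU zl wl).
have sol' : solution_set P (z', w') by exact (weak_cluster_solution Pok parok run sU' zl' wl').
pose s (a : H0) (b : forall j, H j) :=
  gam par * inner a (z - z') + \sum_(j < m) inner (b j) (w j - w' j).
pose c := gam par * (`|z| ^+ 2 - `|z'| ^+ 2) + \sum_(j < m) (`|w j| ^+ 2 - `|w' j| ^+ 2).
have sE k : s (zs tr k) (ws tr k) = 2^-1 * (c + dist2 par tr k z' w' - dist2 par tr k z w).
  have sq (V : hilbertType R) (p a b : V) :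
      2 * inner p (a - b) = `|a| ^+ 2 - `|b| ^+ 2 + `|p - b| ^+ 2 - `|p - a| ^+ 2.
    by rewrite -!inner_sqr !innerE (innerC a p) (innerC b p); ring.
  have h1 := sq _ (zs tr k) z z'.
  have h2 : 2 * \sum_(j < m) inner (ws tr k j) (w j - w' j)
     = \sum_(j < m) (`|w j| ^+ 2 - `|w' j| ^+ 2) + \sum_(j < m) `|ws tr k j - w' j| ^+ 2
       - \sum_(j < m) `|ws tr k j - w j| ^+ 2.
    by rewrite mulr_sumr -big_split/= -sumrB; apply: eq_bigr => j _; rewrite sq.
  rewrite /s /c /dist2.
  have -> : inner (zs tr k) (z - z') = 2^-1 * (2 * inner (zs tr k) (z - z')) by field.
  have -> : \sum_(j < m) inner (ws tr k j) (w j - w' j)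
     = 2^-1 * (2 * \sum_(j < m) inner (ws tr k j) (w j - w' j)) by field.
  by rewrite h1 h2; ring.
have [l sl] : exists l : R, s (zs tr k.+1) (ws tr k.+1) @[k --> \oo] --> l.
  have /cvg_ex[d hd] := dist2_cvg Pok parok run sol.
  have /cvg_ex[d' hd'] := dist2_cvg Pok parok run sol'.
  exists (2^-1 * (c + d' - d)).
  rewrite (cvg_shiftS (fun k => s (zs tr k) (ws tr k))); under eq_cvg do rewrite sE.
  apply: cvgM; first exact: cvg_cst.
  by apply: cvgB => //; apply: cvgD => //; exact: cvg_cst.
have lim (V : set_system nat) a b : ProperFilter V -> \oo `<=` V ->
    weak_limit_along V a b -> l = s a b.
  move=> PV sV [al bl].
  have sab : s (zs tr k.+1) (ws tr k.+1) @[k --> V] --> s a b.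
    apply: cvgD; first by apply: cvgM => //; exact: cvg_cst.
    by apply: cvg_sumr => j; exact: bl.
  by apply: (cvg_unique _ (cvg_sub_filter sV sl) sab).
have eqs : s z w = s z' w' by rewrite -(lim U z w)// -(lim U' z' w').
have g0 : 0 < gam par by case: parok.
have sq0 : gam par * `|z - z'| ^+ 2 + \sum_(j < m) `|w j - w' j| ^+ 2 = 0.
  transitivity (s z w - s z' w'); last by rewrite eqs subrr.
  rewrite /s opprD addrACA -mulrBr -sumrB -inner_sqr innerDl innerNl.
  congr (_ + _); apply: eq_bigr => j _.
  by rewrite -inner_sqr innerDl innerNl.
move/eqP: sq0; rewrite paddr_eq0; last by apply: sumr_ge0 => j _; rewrite exprn_ge0.
  rewrite mulf_eq0 (gt_eqF g0)/= sqrf_eq0 normr_eq0 subr_eq0 => /andP[/eqP -> w0].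
  split=> // j; move: w0; rewrite psumr_eq0 => [/allP/(_ j (mem_index_enum _))|j' _].
    by rewrite /= sqrf_eq0 normr_eq0 subr_eq0 => /eqP.
  by rewrite exprn_ge0.
by rewrite mulr_ge0 ?exprn_ge0// ltW.
Qed.

Lemma iterates_weak_cvg : exists z w, solution_set P (z, w) /\ weak_limit_along \oo z w.
Proof.
have [U [UU sU]] := @ultraFilterLemma _ (\oo : set_system nat) _.
have [z [w lU]] := weak_limit_exists UU.
exists z, w; split.
  by have [zl wl] := lU; exact: (weak_cluster_solution Pok parok run sU zl wl).
have agree U' : UltraFilter U' -> \oo `<=` U' -> weak_limit_along U' z w.
  move=> UU' sU'; have [z' [w' lU']] := weak_limit_exists UU'.
  have [zz ww] := weak_limits_agree _ _ sU sU' lU lU'; have [zl' wl'] := lU'.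
  by split=> [h|j h]; [rewrite zz; exact: zl' | rewrite ww; exact: wl'].
split=> [h|j h]; apply: cvg_from_ultra => U' UU' sU'; have [zl wl] := agree U' UU' sU'.
  exact: zl.
exact: wl.
Qed.
End Opial.

Theorem theorem1 (R : realType) (m : nat) (H0 : hilbertType R)
    (H : 'I_m -> hilbertType R) (P : problem H0 H) (par : parameters H0 H)
    (tr : trace H0 H) :
  problem_ok P -> parameters_ok P par ->
  (forall K : nat, terminates_at P par tr K ->
     solution_set P (zs tr K.+1, ws tr K.+1)) /\
  (runs_forever P par tr ->
   exists zbar wbar,
     [/\ solution_set P (zbar, wbar),
         weak_cvg (@prod_inner R m H0 H) (fun k => (zs tr k, ws tr k)) (zbar, wbar),
         forall j : 'I_m,
           weak_cvg inner (fun k => xs tr k (Some j)) (linG P j zbar) /\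
           weak_cvg inner (fun k => ys tr k (Some j)) (wbar j),
         weak_cvg inner (fun k => xs tr k None) zbar
       & weak_cvg inner (fun k => ys tr k None)
           (- \sum_(j < m) adjoint (linG P j) (wbar j))]).
Proof.
move=> Pok parok; split=> [K|run]; first exact: terminates_solution.
have [z [w [sol [zl wl]]]] := iterates_weak_cvg Pok parok run.
have xl i h : inner (xs tr k i) h @[k --> \oo] --> inner (mapG P i z) h.
  rewrite -(cvg_shiftS (fun k => inner (xs tr k i) h)).
  exact: (X_weak Pok parok run _ zl).
have yl i h : inner (ys tr k i) h @[k --> \oo] --> inner (w_ext P w i) h.
  rewrite -(cvg_shiftS (fun k => inner (ys tr k i) h)).
  exact: (Y_weak Pok parok run _ wl).
exists z, w; split => //.
- move=> [a b]; rewrite /prod_inner /=.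
  apply: cvgD.
    by rewrite -(cvg_shiftS (fun k => inner (zs tr k) a)); exact: zl.
  apply: cvg_sumr => j.
  by rewrite -(cvg_shiftS (fun k => inner (ws tr k j) (b j))); exact: wl.
- by move=> j; split=> h; [exact: (xl (Some j)) | exact: (yl (Some j))].
Qed.
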